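(* Fix an integer $d\geq 2$. There is a constant $c>0$ such that the following holds. Suppose that for some $\varepsilon>0$ there is an algorithm which, given two rooted unordered trees $H$ and $G$, each with at most $n$ vertices, in which every vertex has at most $d$ children and whose heights are at most $\log_d n + c\log\log n$, computes the size of a largest common subtree of $H$ and $G$ in time $O(n^{2-\varepsilon})$. Then the Strong Exponential Time Hypothesis (SETH) is false.
   Context: For rooted unordered trees $H$ and $G$, a common subtree is a rooted tree $T$ that is isomorphic to a subtree of $H$ and to a subtree of $G$, where $T$ being isomorphic to a subtree of $X$ means there is an injective map $f$ from the vertices of $T$ to the vertices of $X$ with $f(\mathrm{root}(T))=\mathrm{root}(X)$ such that whenever $c$ is a child of $p$ in $T$, $f(c)$ is a child of $f(p)$ in $X$. The Largest Common Subtree problem asks for the maximum number of vertices of a common subtree of $H$ and $G$. The height of a rooted tree is the maximum number of edges on a root-to-leaf path. SETH: for every $\varepsilon>0$ there is an integer $k$ such that $k$-SAT on $n$ variables cannot be solved in time $O(2^{(1-\varepsilon)n}\mathrm{poly}(n))$. *)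

(* Defs.v *)
From mathcomp Require Import all_boot all_order all_algebra.
From mathcomp Require Import reals exp.

Set Implicit Arguments.
Unset Strict Implicit.
Unset Printing Implicit Defensive.

Import Order.TTheory GRing.Theory Num.Theory.

(* Deterministic algorithms are while-programs of a random access machine with
   natural-number variables and arrays, under the logarithmic cost criterion
   (Cook-Reckhow): every value produced is charged its bit length, so that
   arithmetic on long integers is not free. Up to factors polylogarithmic in
   the running time, this agrees with the unit-cost RAM with words of
   logarithmic length; such factors are absorbed by an arbitrarily
   small change of the exponents eps below. *)

Inductive binop := Add | Sub | Mul | Div.

Inductive expr :=
| Cst of nat
| Var of nat
| Get of nat & expr                       (* array, index *)
| Bin of binop & expr & expr.

Inductive cmd :=
| Skip
| Assign of nat & expr
| Store of nat & expr & expr              (* array, index, value *)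
| Seq of cmd & cmd
| If of expr & cmd & cmd                  (* a test holds when it is nonzero *)
| While of expr & cmd.

Record state := State { vars : nat -> nat; arrs : nat -> nat -> nat }.

Definition bitlen (n : nat) : nat := (trunc_log 2 n).+1.

Definition eval_binop (o : binop) : nat -> nat -> nat :=
  match o with Add => addn | Sub => subn | Mul => muln | Div => divn end.

Fixpoint eval (s : state) (e : expr) : nat :=
  match e with
  | Cst n => n
  | Var x => vars s x
  | Get a e1 => arrs s a (eval s e1)
  | Bin o e1 e2 => eval_binop o (eval s e1) (eval s e2)
  end.

Fixpoint ecost (s : state) (e : expr) : nat :=
  bitlen (eval s e) +
  match e with
  | Cst _ | Var _ => 0
  | Get _ e1 => ecost s e1
  | Bin _ e1 e2 => ecost s e1 + ecost s e2
  end.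

Definition upd (T : Type) (f : nat -> T) (x : nat) (v : T) : nat -> T :=
  fun y => if y == x then v else f y.

Definition set_var (s : state) (x v : nat) : state :=
  State (upd (vars s) x v) (arrs s).

Definition set_arr (s : state) (a i v : nat) : state :=
  State (vars s) (upd (arrs s) a (upd (arrs s a) i v)).

(* exec p s t s' : started in s, p halts in s' after time t. *)
Inductive exec : cmd -> state -> nat -> state -> Prop :=
| ExecSkip s : exec Skip s 1 s
| ExecAssign x e s :
    exec (Assign x e) s (ecost s e) (set_var s x (eval s e))
| ExecStore a e1 e2 s :
    exec (Store a e1 e2) s (ecost s e1 + ecost s e2)
         (set_arr s a (eval s e1) (eval s e2))
| ExecSeq p q s s1 s2 t1 t2 :
    exec p s t1 s1 -> exec q s1 t2 s2 -> exec (Seq p q) s (t1 + t2) s2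
| ExecIfTrue e p q s s1 t :
    eval s e != 0 -> exec p s t s1 -> exec (If e p q) s (ecost s e + t) s1
| ExecIfFalse e p q s s1 t :
    eval s e = 0 -> exec q s t s1 -> exec (If e p q) s (ecost s e + t) s1
| ExecWhileTrue e p s s1 s2 t1 t2 :
    eval s e != 0 -> exec p s t1 s1 -> exec (While e p) s1 t2 s2 ->
    exec (While e p) s (ecost s e + t1 + t2) s2
| ExecWhileFalse e p s :
    eval s e = 0 -> exec (While e p) s (ecost s e) s.

(* The input is stored in array 0 and its length in variable 0; everything else
   is zero. The output is the final value of variable 0. *)
Definition init (w : seq nat) : state :=
  State (upd (fun=> 0) 0 (size w)) (upd (fun=> fun=> 0) 0 (nth 0 w)).

Definition run (p : cmd) (w : seq nat) (v t : nat) : Prop :=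
  exists s, exec p (init w) t s /\ vars s 0 = v.

(* Rooted unordered trees, with the convention that the root is its own
   parent. *)
Record rtree := RTree {
  tsize : nat;
  root : 'I_tsize;
  parent : 'I_tsize -> 'I_tsize;
  parent_root : parent root = root;
  root_reachable : forall v, fconnect parent v root
}.

Definition child (T : rtree) (p c : 'I_(tsize T)) : bool :=
  (c != root T) && (parent c == p).

Definition max_children (d : nat) (T : rtree) : Prop :=
  forall p : 'I_(tsize T), #|[pred c | child p c]| <= d.

Definition leaf (T : rtree) (v : 'I_(tsize T)) : bool :=
  [forall c, ~~ child v c].

Definition depth (T : rtree) (v : 'I_(tsize T)) : nat :=
  findex (@parent T) v (root T).

Definition height (T : rtree) : nat :=
  \max_(v : 'I_(tsize T) | leaf v) depth v.

Definition embeds (T X : rtree) : Prop :=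
  exists f : 'I_(tsize T) -> 'I_(tsize X),
    [/\ injective f, f (root T) = root X &
        forall p c, child p c -> child (f p) (f c)].

Definition common_subtree (T H G : rtree) : Prop := embeds T H /\ embeds T G.

Definition largest_common_subtree_size (H G : rtree) (m : nat) : Prop :=
  (exists2 T, common_subtree T H G & tsize T = m) /\
  (forall T, common_subtree T H G -> tsize T <= m).

Definition tree_code (T : rtree) : seq nat :=
  tsize T :: val (root T) :: [seq val (parent v) | v <- enum 'I_(tsize T)].

(* The literal (i, b) holds under an assignment that gives variable i the
   value b. *)
Definition literal (n : nat) : Type := ('I_n * bool)%type.
Definition cnf (n : nat) : Type := seq (seq (literal n)).

(* Clauses are not repeated, so that a k-CNF has at most polynomially many
   clauses in n. *)
Definition is_kcnf (k n : nat) (F : cnf n) : bool :=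
  uniq F && all (fun cl => size cl <= k) F.

Definition satisfiable (n : nat) (F : cnf n) : bool :=
  [exists a : {ffun 'I_n -> bool}, all (has (fun l => a l.1 == l.2)) F].

Definition clause_code (n : nat) (cl : seq (literal n)) : seq nat :=
  size cl :: [seq (val l.1).*2 + nat_of_bool l.2 | l : literal n <- cl].

Definition cnf_code (n : nat) (F : cnf n) : seq nat :=
  n :: size F :: flatten [seq clause_code cl | cl <- F].

Local Open Scope ring_scope.

Definition logb (R : realType) (b x : R) : R := ln x / ln b.

Definition kSAT_in_time (R : realType) (k : nat) (eps : R) : Prop :=
  exists (p : cmd) (C : R) (e : nat),
  forall (n : nat) (F : cnf n), is_kcnf k F ->
  exists2 t : nat, run p (cnf_code F) (satisfiable F) t &
    t%:R <= C * 2 `^ ((1 - eps) * n%:R) * n.+1%:R ^+ e.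

Definition SETH (R : realType) : Prop :=
  forall eps : R, 0 < eps -> exists k : nat, ~ kSAT_in_time k eps.

Definition LCS_algorithm (R : realType) (d : nat) (c eps : R) (p : cmd) : Prop :=
  exists C : R, forall (n : nat) (H G : rtree), (2 <= n)%N ->
  (tsize H <= n)%N -> (tsize G <= n)%N ->
  max_children d H -> max_children d G ->
  (height H)%:R <= logb d%:R n%:R + c * logb 2 (logb 2 n%:R) ->
  (height G)%:R <= logb d%:R n%:R + c * logb 2 (logb 2 n%:R) ->
  exists m t : nat,
    [/\ run p (tree_code H ++ tree_code G) m t,
        largest_common_subtree_size H G m &
        t%:R <= C * n%:R `^ (2 - eps)].

(* Main.v *)
From mathcomp Require Import all_boot all_order all_algebra zify lra.
From mathcomp Require Import reals exp.
Require Import Defs.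

Set Implicit Arguments.
Unset Strict Implicit.
Unset Printing Implicit Defensive.

Import Order.TTheory GRing.Theory Num.Theory.

(** Split the variables of a k-CNF with m clauses into two halves. Every
assignment of a half gives the vector of the clauses that it leaves unsatisfied,
and the formula is satisfiable iff some vector of the first half is orthogonal
to some vector of the second. A vector becomes a binary tree of size O(m) and
height O(log m), its gadget, such that the first-half gadget of a embeds in the
second-half gadget of b iff a and b are orthogonal. One extra coordinate
is 1 in all first-half vectors and 0 in all second-half vectors; hence F, the
second-half gadget of the vector that is 1 at this coordinate only, contains
every first-half gadget up to one vertex, but never the whole of it.

H is the complete d-ary tree of height h, with d^h about 2^(n/2), and one
first-half gadget below each leaf; G has a second-half gadget and a copy of F
below each leaf. An embedding that covers a whole gadget of H yields an
orthogonal pair, so without such a pair a common subtree misses at least d^h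
vertices of H. If (i, j) is an orthogonal pair, an automorphism of the d-ary
tree moves leaf i to leaf j; matching gadget i with gadget j and all others
with F misses only d^h - 1 vertices.

Sparsification is not needed: m is polynomial in n, so H and G have
2^(n/2) poly(n) vertices and height log_d 2^(n/2) + O(log n). In the assumed
algorithm n is just an upper bound on the sizes, so it may be taken larger by
a polynomial factor that pays for the height of the gadgets, and c = 1 works. *)

(** * Rooted trees given by a parent function *)

Section RootedTrees.

Implicit Types T X : rtree.

Lemma iter_depth T (v : 'I_(tsize T)) : iter (depth v) (@parent T) v = root T.
Proof. exact/iter_findex/root_reachable. Qed.

Lemma depth_le T (v : 'I_(tsize T)) k :
  iter k (@parent T) v = root T -> depth v <= k.
Proof.
move=> Ek; rewrite leqNgt; apply/negP => lt_k.
have lt_ko : k < order (@parent T) v.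
  by apply: ltn_trans lt_k _; apply: findex_max; apply: root_reachable.
have := findex_iter lt_ko; rewrite Ek => E.
by move: lt_k; rewrite /depth E ltnn.
Qed.

Lemma depth_root T : depth (root T) = 0.
Proof. by apply/eqP; rewrite -leqn0; apply: depth_le. Qed.

Lemma depth_parent T (v : 'I_(tsize T)) :
  v != root T -> depth v = (depth (parent v)).+1.
Proof.
move=> nv; apply/eqP; rewrite eqn_leq; apply/andP; split.
  by apply: depth_le; rewrite iterSr iter_depth.
have := iter_depth v; case Ed: (depth v) => [|k] /=.
  by move=> E; rewrite E eqxx in nv.
by rewrite -iterS iterSr ltnS => /depth_le.
Qed.

Lemma embed_parent T X (f : 'I_(tsize T) -> 'I_(tsize X)) :
  f (root T) = root X -> (forall p c, child p c -> child (f p) (f c)) ->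
  forall v, parent (f v) = f (parent v).
Proof.
move=> f0 fC v; have [->|nv] := eqVneq v (root T).
  by rewrite parent_root f0 parent_root.
by have /fC/andP[_ /eqP] : child (parent v) v by rewrite /child nv eqxx.
Qed.

Lemma embed_depth T X (f : 'I_(tsize T) -> 'I_(tsize X)) :
  injective f -> f (root T) = root X ->
  (forall v, parent (f v) = f (parent v)) -> forall v, depth (f v) = depth v.
Proof.
move=> f_inj f0 fP v.
have fI k w : iter k (@parent X) (f w) = f (iter k (@parent T) w).
  by elim: k => //= k ->.
apply/eqP; rewrite eqn_leq !depth_le ?fI ?iter_depth //.
by apply: f_inj; rewrite -fI iter_depth.
Qed.

(** A set closed under parents is itself a rooted tree, renumbered along its enumeration; its
    inclusion into [H] and the restriction of [e] are the two embeddings. Off [P], the values of [e]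
    are arbitrary. *)
Lemma common_subtree_of_map H G (P : pred 'I_(tsize H))
    (e : 'I_(tsize H) -> 'I_(tsize G)) :
  P (root H) -> (forall v, P v -> P (parent v)) ->
  {in P &, injective e} -> e (root H) = root G ->
  (forall v, P v -> v != root H -> parent (e v) = e (parent v)) ->
  exists2 T, common_subtree T H G & tsize T = #|P|.
Proof.
move=> P0 PP e_inj e0 eP.
have rP : root H \in P by [].
pose rk := enum_rank_in rP.
have rkK v : v \in P -> enum_val (rk v) = v by exact: enum_rankK_in.
have vP (t : 'I_#|P|) : enum_val t \in P by exact: enum_valP.
pose par (t : 'I_#|P|) := rk (parent (enum_val t)).
have par0 : par (rk (root H)) = rk (root H) by rewrite /par rkK // parent_root.
have parE t : enum_val (par t) = parent (enum_val t).
  by rewrite rkK //; apply: PP; apply: vP.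
have reach t : fconnect par t (rk (root H)).
  have itE k : enum_val (iter k par t) = iter k (@parent H) (enum_val t).
    by elim: k => //= k <-; rewrite parE.
  suff <- : iter (depth (enum_val t)) par t = rk (root H) by apply: fconnect_iter.
  by apply: enum_val_inj; rewrite itE iter_depth rkK.
exists (RTree par0 reach) => //; split.
  exists (fun t => enum_val t); split; first exact: enum_val_inj.
    by rewrite /= rkK.
  move=> p c /andP[/= nc /eqP <-]; rewrite /child /= parE eqxx andbT.
  by apply: contra nc => /eqP E; apply/eqP/enum_val_inj; rewrite rkK.
exists (fun t => e (enum_val t)); split.
- by move=> s t /e_inj E; apply: enum_val_inj; apply: E; apply: vP.
- by rewrite /= rkK.
move=> p c /andP[/= nc /eqP <-].
have nc' : enum_val c != root H.
  by apply: contra nc => /eqP E; apply/eqP/enum_val_inj; rewrite rkK.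
rewrite /child parE eP ?eqxx ?andbT //; last exact: vP.
by apply: contra nc' => /eqP E; apply/eqP/e_inj; rewrite ?E ?e0 //; apply: vP.
Qed.

(** The labels inject the children of a vertex into ['I_d], so only siblings have to be told
    apart. *)
Lemma max_children_label d T (lab : 'I_(tsize T) -> 'I_d) :
  (forall v w, v != root T -> w != root T ->
     parent v = parent w -> lab v = lab w -> v = w) ->
  max_children d T.
Proof.
move=> lab_inj p; rewrite -[leqRHS]card_ord -(@card_in_imset _ _ lab).
  exact: max_card.
move=> v w /andP[nv /eqP pv] /andP[nw /eqP pw]; apply: lab_inj => //.
by rewrite pv pw.
Qed.

End RootedTrees.

Section TreeOfParent.

Variables (S Hb : nat) (par : nat -> nat).
Hypothesis S_gt0 : 0 < S.
Hypothesis par0 : par 0 = 0.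
Hypothesis par_lt : forall v, v < S -> par v < S.
Hypothesis par_iter : forall v, v < S -> exists2 k, k <= Hb & iter k par v = 0.

Definition ord_par (v : 'I_S) : 'I_S := Ordinal (par_lt (ltn_ord v)).

Lemma val_iter_ord_par k (v : 'I_S) : iter k ord_par v = iter k par v :> nat.
Proof. by elim: k => //= k ->. Qed.

Lemma iter_ord_par (v : 'I_S) :
  exists2 k, k <= Hb & iter k ord_par v = Ordinal S_gt0.
Proof.
have [k le_k Ek] := par_iter (ltn_ord v).
by exists k => //; apply: val_inj; apply: etrans (val_iter_ord_par k v) Ek.
Qed.

Lemma ord_par_root : ord_par (Ordinal S_gt0) = Ordinal S_gt0.
Proof. exact: val_inj. Qed.

Lemma ord_par_reach (v : 'I_S) : fconnect ord_par v (Ordinal S_gt0).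
Proof. by have [k _ <-] := iter_ord_par v; apply: fconnect_iter. Qed.

Definition tree_of_par : rtree := RTree ord_par_root ord_par_reach.

Lemma height_tree_of_par : height tree_of_par <= Hb.
Proof.
apply/bigmax_leqP => v _; have [k le_k Ek] := iter_ord_par v.
exact: leq_trans (depth_le (T := tree_of_par) Ek) le_k.
Qed.

Lemma tree_code_tree_of_par :
  tree_code tree_of_par = S :: 0 :: [seq par v | v <- iota 0 S].
Proof.
rewrite /tree_code /=; congr [:: _, _ & _].
by rewrite -val_enum_ord -map_comp.
Qed.

End TreeOfParent.

(** * The coordinate gadget *)

(* The gadget of a vector with D coordinates, for H (sd = false, 7 * D vertices)
   or for G (sd = true, 8 * D vertices). The vertices j < 2 * D are a binary heap,
   whose leaf D + c carries coordinate c. Vertex 2 * D + v lies between heap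
   vertex v and its odd child: the children of v are thus distinguishable. Below
   D + c there are two paths D + c, 3 * D + c, 5 * D + c and D + c, 4 * D + c;
   in H, vertex 6 * D + c prolongs the first one if the bit is 1 and the second
   one otherwise. In G, it always prolongs the second one, and 7 * D + c prolongs
   the first one if the bit is 0, and is pendant at 3 * D + c otherwise. *)
Definition gadget_par (sd : bool) (D : nat) (bit : nat -> bool) (j : nat) : nat :=
  if j < 2 * D then (if odd j then 2 * D + j./2 else j./2)
  else if j < 4 * D then j - 2 * D
  else if j < 5 * D then j - 3 * D
  else if j < 6 * D then j - 2 * D
  else if j < 7 * D then
    (if ~~ sd && bit (j - 6 * D) then j - D else j - 2 * D)
  else (if bit (j - 7 * D) then j - 4 * D else j - 2 * D).

(* Tells siblings apart. *)
Definition gadget_label (D j : nat) : nat :=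
  if j < 2 * D then 0 else if j < 3 * D then 1 else if j < 4 * D then 0
  else if j < 5 * D then 1 else if j < 7 * D then 0 else 1.

Definition gadget_size (D : nat) (sd : bool) : nat := (7 + sd) * D.

(* The number of binary digits of j, with value 0 at j = 0. *)
Definition bit_size j := trunc_log 2 j.*2.

Lemma bit_size_half j : 0 < j -> bit_size j = (bit_size j./2).+1.
Proof.
rewrite /bit_size => j0; rewrite (@trunc_log2S j.*2) ?doubleK; last lia.
congr _.+1; case: (ltnP 1 j) => j1; last by have -> : j = 1 by lia.
rewrite trunc_log2S // (@trunc_log2S j./2.*2) ?doubleK //; lia.
Qed.

Lemma bit_size_le j k : j <= k -> bit_size j <= bit_size k.
Proof. by move=> le_jk; apply: leq_trunc_log; rewrite leq_double. Qed.

Section Gadget.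

Variable D : nat.
Hypothesis D_gt0 : 0 < D.
Implicit Types (sd : bool) (bit : nat -> bool).

Lemma gadget_size_gt0 sd : 0 < gadget_size D sd.
Proof. by rewrite muln_gt0 D_gt0. Qed.

Lemma gadget_par_lt sd bit j : j < gadget_size D sd -> gadget_par sd D bit j <
  gadget_size D sd.
Proof. by rewrite /gadget_size /gadget_par; case: sd => /=; repeat case: ifP => ?;
  lia. Qed.

Lemma gadget_par_label_inj sd bit j1 j2 :
  0 < j1 < gadget_size D sd -> 0 < j2 < gadget_size D sd ->
  gadget_par sd D bit j1 = gadget_par sd D bit j2 -> gadget_label D j1 = gadget_label D
    j2 -> j1 = j2.
Proof.
(* Inversion of [gadget_par]: each range of [j] ties [j], its parent [p] and its label [l] by linear
   relations, so that equal parents and labels force equal vertices by arithmetic. *)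
have cases j : 0 < j < gadget_size D sd -> let p := gadget_par sd D bit j in
    let l := gadget_label D j in
    j < 2 * D /\ l = 0 /\ (j = 2 * p /\ p < D \/ j + 4 * D = 2 * p + 1 /\ 2 * D <= p <
      3 * D) \/
    j < 3 * D /\ l = 1 /\ j = p + 2 * D /\ p < D \/
    j < 4 * D /\ l = 0 /\ j = p + 2 * D /\ D <= p < 2 * D \/
    j < 5 * D /\ l = 1 /\ j = p + 3 * D /\ D <= p < 2 * D \/
    j < 6 * D /\ l = 0 /\ j = p + 2 * D /\ 3 * D <= p < 4 * D \/
    j < 7 * D /\ l = 0 /\ (sd = false /\ j = p + D /\ 5 * D <= p < 6 * D \/ j = p + 2 *
      D /\ 4 * D <= p < 5 * D) \/
    sd = true /\ 7 * D <= j < 8 * D /\ l = 1 /\ (j = p + 4 * D /\ 3 * D <= p < 4 * D \/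
      j = p + 2 * D /\ 5 * D <= p < 6 * D).
  by rewrite /gadget_size /gadget_par /gadget_label; case: (sd) => /=;
    repeat (case: ifP => ?; try lia); lia.
move=> /cases + /cases + E L; rewrite /= -{}E -{}L.
set p := gadget_par _ _ _ _; set l := gadget_label _ _.
by do 2 ![case=> [?|]]; lia.
Qed.

(** A heap level costs at most two steps, as an odd child reaches its heap parent through the vertex
    between them; from the paths below a heap leaf, at most three steps lead back into the heap. *)
Lemma iter_gadget_par sd bit j : j < gadget_size D sd ->
  exists2 k, k <= 2 * bit_size (2 * D) + 3 & iter k (gadget_par sd D bit) j = 0.
Proof.
have heap n : n < 2 * D -> exists2 k, k <= 2 * bit_size n & iter k (gadget_par sd D
  bit) n = 0.
  have [N] := ubnP n; elim: N n => // N IHN n lt_nN lt_n.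
  have [->|n0] := posnP n; first by exists 0.
  have [||k le_k Ek] := IHN n./2; [lia|lia|].
  have := bit_size_half n0 => E.
  have [on|en] := boolP (odd n).
    exists k.+2; first lia.
    rewrite !iterSr.
    have -> : gadget_par sd D bit n = 2 * D + n./2 by rewrite /gadget_par lt_n on.
    by rewrite {2}/gadget_par; repeat case: ifP => ?; try lia; rewrite addKn.
  exists k.+1; first lia.
  by rewrite iterSr {2}/gadget_par lt_n (negPf en).
pose R := 2 * bit_size (2 * D).
have lift n b : n < 2 * D ->
    (exists2 i, i <= b & iter i (gadget_par sd D bit) j = n) ->
  exists2 k, k <= R + b & iter k (gadget_par sd D bit) j = 0.
  move=> lt_n [i le_i Ei]; have [k le_k Ek] := heap _ lt_n.
  exists (k + i); last by rewrite iterD Ei.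
  by have := bit_size_le (ltnW lt_n); lia.
move=> lt_j.
have j8 : j < 8 * D by apply: leq_trans lt_j _; rewrite /gadget_size leq_mul2r;
  case: (sd) => /=; lia.
case: (ltnP j (2 * D)) => j2; first by apply: (lift j) => //; exists 0.
case: (ltnP j (3 * D)) => j3.
  apply: (lift (j - 2 * D)); first lia.
  by exists 1 => //=; rewrite /gadget_par; repeat case: ifP => ?; lia.
case: (ltnP j (5 * D)) => j5.
  apply: (lift (gadget_par sd D bit j)); last by exists 1.
  by rewrite /gadget_par; repeat case: ifP => ?; lia.
case: (ltnP j (6 * D)) => j6.
  apply: (lift (gadget_par sd D bit (gadget_par sd D bit j))); last by exists 2.
  have -> : gadget_par sd D bit j = j - 2 * D.
    by rewrite /gadget_par; repeat case: ifP => ?; lia.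
  by rewrite /gadget_par; repeat case: ifP => ?; lia.
have : gadget_par sd D bit j < 4 * D /\ 3 * D <= gadget_par sd D bit j \/
       4 * D <= gadget_par sd D bit j < 6 * D.
  by rewrite /gadget_par; repeat case: ifP => ?; lia.
set w := gadget_par sd D bit j => wP.
have : 2 * D <= w < 5 * D /\ gadget_par sd D bit w < 2 * D \/ 5 * D <= w < 6 * D /\
  gadget_par sd D bit (gadget_par sd D bit w) < 2 * D.
  case: (ltnP w (5 * D)) => w5; [left|right]; split; try lia.
    by rewrite /gadget_par; repeat case: ifP => ?; lia.
  have -> : gadget_par sd D bit w = w - 2 * D.
    by rewrite /gadget_par; repeat case: ifP => ?; lia.
  by rewrite /gadget_par; repeat case: ifP => ?; lia.
case=> -[_ lt_w]; first by apply: (lift _ 3 lt_w); exists 2.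
by apply: (lift _ 3 lt_w); exists 3.
Qed.

(* A root-preserving embedding of the gadget of [a] into that of [b] fixes the
   heap: the even child 2w has two children, whereas the vertex 2D+w above the
   odd child 2w+1 has only one. Then [a c] and [b c] cannot both hold, as a path
   with three edges would have to fit below a vertex with height two. *)
Lemma gadget_embedding_orthogonal (a b : nat -> bool) (phi : nat -> nat) :
  phi 0 = 0 ->
  (forall j, 0 < j < 7 * D ->
     0 < phi j < 8 * D /\ gadget_par true D b (phi j) = phi (gadget_par false D a j)) ->
  (forall i j, i < 7 * D -> j < 7 * D -> phi i = phi j -> i = j) ->
  forall c, c < D -> ~~ (a c && b c).
Proof.
move=> phi0 phiP phi_inj.
have step i j : 0 < i < 7 * D -> gadget_par false D a i = j ->
    0 < phi i < 8 * D /\ gadget_par true D b (phi i) = phi j.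
  by move=> /phiP [? E] <-.
have heap v : v < 2 * D -> phi v = v.
  have [N] := ubnP v; elim: N v => // N IHN v lt_vN lt_v.
  have [->//|v0] := posnP v.
  (* Vertex 1 is apart: vertex 0 is its own even child, so its only other child is [2 * D], whose
     only child is 1. *)
  have [v1|v1] := eqVneq v 1.
    have E : phi (2 * D) = 2 * D.
      have [||] := @step (2 * D) 0; first lia.
        by rewrite /gadget_par; repeat case: ifP => ?; lia.
      by rewrite phi0 /gadget_par; repeat case: ifP => ?; lia.
    rewrite {}v1 in lt_v *.
    have [||] := @step 1 (2 * D); first lia.
      by rewrite /gadget_par; repeat case: ifP => ?; lia.
    by rewrite E /gadget_par; repeat case: ifP => ?; lia.
  pose w := v./2.
  have w0 : 0 < w < D by rewrite /w; lia.
  have Ew : phi w = w by apply: IHN; rewrite /w; lia.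
  have even_or z : 0 < z < 8 * D -> gadget_par true D b z = w -> z = 2 * w \/ z = 2 * D
    + w.
    by rewrite /gadget_par; repeat case: ifP => ?; lia.
  have odd_is z : 0 < z < 8 * D -> gadget_par true D b z = 2 * D + w -> z = 2 * w + 1.
    by rewrite /gadget_par; repeat case: ifP => ?; lia.
  have p2 : gadget_par false D a (2 * w) = w.
    by rewrite /gadget_par; repeat case: ifP => ?; lia.
  have p1 : gadget_par false D a (2 * D + w) = w.
    by rewrite /gadget_par; repeat case: ifP => ?; lia.
  have p3 : gadget_par false D a (2 * w + 1) = 2 * D + w.
    by rewrite /gadget_par; repeat case: ifP => ?; lia.
  have [|r2 e2] := step _ _ _ p2; first lia.
  have [|r1 e1] := step _ _ _ p1; first lia.
  have [|r3 e3] := step _ _ _ p3; first lia.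
  rewrite Ew in e1 e2.
  have ne : phi (2 * w) <> phi (2 * D + w) by move=> /phi_inj E; lia.
  (* The two children [s1] and [s2] of [2 * w] would both go to the only child of [2 * D + w]. If
     [2 * w] is a heap leaf [D + c], they are [3 * D + c] and [4 * D + c]. *)
  have no : phi (2 * w) <> 2 * D + w.
    move=> E.
    pose s1 := if 2 * w < D then 4 * w else 2 * D + 2 * w.
    pose s2 := if 2 * w < D then 2 * D + 2 * w else 3 * D + 2 * w.
    have q1 : gadget_par false D a s1 = 2 * w.
      by rewrite /s1; case: (ltnP (2 * w) D) => ?; rewrite /gadget_par;
        repeat case: ifP => ?; lia.
    have q2 : gadget_par false D a s2 = 2 * w.
      by rewrite /s2; case: (ltnP (2 * w) D) => ?; rewrite /gadget_par;
        repeat case: ifP => ?; lia.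
    have [|t1 f1] := step _ _ _ q1; first by rewrite /s1; case: ifP => ?; lia.
    have [|t2 f2] := step _ _ _ q2; first by rewrite /s2; case: ifP => ?; lia.
    rewrite E in f1 f2.
    have : s1 = s2.
      apply: phi_inj; last by rewrite (odd_is _ t1 f1) (odd_is _ t2 f2).
        by rewrite /s1; case: ifP => ?; lia.
      by rewrite /s2; case: ifP => ?; lia.
    by rewrite /s1 /s2; case: ifP => ?; lia.
  have E2 : phi (2 * w) = 2 * w by case: (even_or _ r2 e2).
  have E1 : phi (2 * D + w) = 2 * D + w.
    by case: (even_or _ r1 e1) => // E; rewrite E2 in ne; rewrite E in ne.
  rewrite E1 in e3; have E3 := odd_is _ r3 e3.
  have [->//|->//] : v = 2 * w \/ v = 2 * w + 1 by rewrite /w; lia.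
move=> c lt_c; apply/negP => /andP [ac bc].
have [||r1 e1] := @step (3 * D + c) (D + c); first lia.
  by rewrite /gadget_par; repeat case: ifP => ?; lia.
have [||r2 e2] := @step (5 * D + c) (3 * D + c); first lia.
  by rewrite /gadget_par; repeat case: ifP => ?; lia.
have [||r3 e3] := @step (6 * D + c) (5 * D + c); first lia.
  by rewrite /gadget_par addKn ac /=; repeat case: ifP => ?; lia.
rewrite (heap (D + c)) in e1; last lia.
have {r1 e1}s1 : phi (3 * D + c) = 3 * D + c \/ phi (3 * D + c) = 4 * D + c.
  by move: e1; rewrite /gadget_par; repeat case: ifP => ?; lia.
have {s1 r2 e2}s2 : [\/ phi (5 * D + c) = 5 * D + c,
    phi (5 * D + c) = 6 * D + c | phi (5 * D + c) = 7 * D + c].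
  suff : phi (5 * D + c) = 5 * D + c \/
    phi (5 * D + c) = 6 * D + c \/ phi (5 * D + c) = 7 * D + c.
    by case=> [|[]]; [constructor 1|constructor 2|constructor 3].
  by move: e2; rewrite /gadget_par; repeat case: ifP => ?; lia.
(* The image of [6 * D + c] needs one of these three as parent; only [5 * D + c] can have a child,
   namely [7 * D + c] when [b c] is false. *)
have b7 z : z = 7 * D + c -> b (z - 7 * D) by move=> ->; rewrite addKn.
move: e3; rewrite /gadget_par; repeat (case: ifP => ?; try by case: s2; lia).
move=> e3; have : phi (6 * D + c) = 7 * D + c by case: s2; lia.
by move/b7; lia.
Qed.

End Gadget.

(** * Gadgets below a complete d-ary tree *)

(* The number of vertices of depth < t in the d-ary tree in heap order, where the
   parent of v > 0 is (v - 1) / d. *)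
Fixpoint heap_offset (d t : nat) : nat := if t is t'.+1 then d * heap_offset d t' + 1
  else 0.

Lemma heap_offsetS d t : heap_offset d t.+1 = heap_offset d t + d ^ t.
Proof.
elim: t => [|t IHt]; first by rewrite /= muln0 expn0.
by rewrite -[LHS]/(d * heap_offset d t.+1 + 1) {1}IHt mulnDr -expnS addnAC.
Qed.

Lemma heap_offset_lt d t : 1 < d -> heap_offset d t < d ^ t.
Proof.
move=> d1; elim: t => //= t IHt; rewrite expnS.
by apply: leq_trans (leq_mul (leqnn d) IHt); rewrite mulnS; lia.
Qed.

Lemma leq_heap_offset d : {homo heap_offset d : s t / s <= t}.
Proof.
by apply: (@homo_leq _ (heap_offset d) leq) => [//|y x z|t];
  [apply: leq_trans | rewrite heap_offsetS leq_addr].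
Qed.

Lemma heap_offset_parent d t v : 0 < d ->
  heap_offset d t.+1 <= v < heap_offset d t.+2 -> heap_offset d t <= v.-1 %/ d <
    heap_offset d t.+1.
Proof.
move=> d0; rewrite leq_divRL // ltn_divLR //= => /andP[]; lia.
Qed.

Section TreePair.

Variables (d h D : nat) (sd : bool) (bits : nat -> nat -> bool).
Hypotheses (d_gt1 : 1 < d) (D_gt0 : 0 < D).

Definition top_size := heap_offset d h.+1.
Definition gadget_count := d ^ h * sd.+1.
Definition tree_size := top_size + gadget_count * gadget_size D sd.
Definition gadget_vertex g j := top_size + g * gadget_size D sd + j.

(* The top d-ary tree, followed by the gadgets in blocks of equal size: one below
   each leaf if sd = false and two if sd = true. *)
Definition tree_par v :=
  if v < top_size then v.-1 %/ d else
  let g := (v - top_size) %/ gadget_size D sd in let j := (v - top_size) %% gadget_size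
    D sd in
  if j == 0 then heap_offset d h + g %/ sd.+1 else top_size + g * gadget_size D sd +
    gadget_par sd D (bits g) j.

Lemma top_size_gt0 : 0 < top_size.
Proof. by rewrite /top_size /= addn1. Qed.

Lemma vertexP v : v < tree_size ->
  v < top_size \/ exists g j, [/\ g < gadget_count, j < gadget_size D sd & v =
    gadget_vertex g j].
Proof.
move=> lt_v; case: (ltnP v top_size) => [|le_v]; [by left | right].
exists ((v - top_size) %/ gadget_size D sd), ((v - top_size) %% gadget_size D sd);
  split.
- by rewrite ltn_divLR ?gadget_size_gt0 // ltn_subLR.
- by rewrite ltn_mod gadget_size_gt0.
by rewrite /gadget_vertex -addnA -divn_eq subnKC.
Qed.

Lemma gadget_vertex_lt g j : g < gadget_count -> j < gadget_size D sd -> gadget_vertex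
  g j < tree_size.
Proof.
move=> lt_g lt_j; rewrite /gadget_vertex /tree_size -addnA ltn_add2l.
by apply: leq_trans (_ : g.+1 * gadget_size D sd <= _);
  rewrite ?leq_mul2r ?lt_g ?orbT // mulSn addnC ltn_add2r.
Qed.

Lemma gadget_vertex_divn g j : j < gadget_size D sd -> (gadget_vertex g j - top_size)
  %/ gadget_size D sd = g.
Proof.
by move=> lt_j; rewrite /gadget_vertex -addnA addKn divnMDl ?gadget_size_gt0 //
  divn_small ?addn0.
Qed.

Lemma gadget_vertex_modn g j : j < gadget_size D sd -> (gadget_vertex g j - top_size)
  %% gadget_size D sd = j.
Proof. by move=> lt_j; rewrite /gadget_vertex -addnA addKn modnMDl modn_small. Qed.

Lemma gadget_vertex_inj g g' j j' : j < gadget_size D sd -> j' < gadget_size D sd ->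
  gadget_vertex g j = gadget_vertex g' j' -> g = g' /\ j = j'.
Proof.
move=> lt_j lt_j' E; split.
  by rewrite -(gadget_vertex_divn g lt_j) E gadget_vertex_divn.
by rewrite -(gadget_vertex_modn g lt_j) E gadget_vertex_modn.
Qed.

Lemma gadget_vertex_ge g j : top_size <= gadget_vertex g j.
Proof. by rewrite /gadget_vertex -addnA leq_addr. Qed.

Lemma tree_par_top v : v < top_size -> tree_par v = v.-1 %/ d.
Proof. by rewrite /tree_par => ->. Qed.

Lemma tree_par_gadget g j : 0 < j < gadget_size D sd ->
  tree_par (gadget_vertex g j) = gadget_vertex g (gadget_par sd D (bits g) j).
Proof.
case/andP=> j0 lt_j; rewrite /tree_par ltnNge gadget_vertex_ge /= gadget_vertex_divn //
  gadget_vertex_modn //.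
by rewrite -[j == 0]leqn0 leqNgt j0.
Qed.

Lemma tree_par_gadget_root g : tree_par (gadget_vertex g 0) = heap_offset d h + g %/
  sd.+1.
Proof.
by rewrite /tree_par ltnNge gadget_vertex_ge /= gadget_vertex_divn ?gadget_vertex_modn
  ?gadget_size_gt0.
Qed.

Lemma leaf_lt g : g < gadget_count -> heap_offset d h + g %/ sd.+1 < top_size.
Proof. by move=> lt_g; rewrite /top_size heap_offsetS ltn_add2l ltn_divLR. Qed.

Lemma tree_par0 : tree_par 0 = 0.
Proof. by rewrite tree_par_top ?top_size_gt0 ?div0n. Qed.

Lemma top_size_le : top_size <= tree_size.
Proof. exact: leq_addr. Qed.

(** For [sd = true] there are two gadgets of [8 * D] vertices per leaf, which gives 16; the top tree
    adds fewer than [2 * d ^ h] vertices. *)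
Lemma tree_size_le : tree_size <= 18 * (d ^ h * D).
Proof.
rewrite /tree_size /top_size /gadget_count /gadget_size heap_offsetS.
have := leq_pmulr (d ^ h) D_gt0; have := heap_offset_lt h d_gt1.
have -> : d ^ h * sd.+1 * ((7 + sd) * D) = (sd.+1 * (7 + sd)) * (d ^ h * D).
  by rewrite [d ^ h * _]mulnC mulnACA.
by case: sd => /=; lia.
Qed.

Lemma tree_size_gt0 : 0 < tree_size.
Proof. exact: leq_trans top_size_gt0 top_size_le. Qed.

Lemma tree_par_lt v : v < tree_size -> tree_par v < tree_size.
Proof.
case/vertexP=> [lt_v|[g [j [lt_g lt_j ->]]]].
  rewrite tree_par_top //; apply: leq_ltn_trans (leq_div _ _) _.
  by apply: leq_trans top_size_le; lia.
have [->|j0] := posnP j.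
  by rewrite tree_par_gadget_root; apply: leq_trans (leaf_lt lt_g) top_size_le.
by rewrite tree_par_gadget ?j0 // gadget_vertex_lt // gadget_par_lt.
Qed.

Lemma iter_tree_par_top t v : t <= h -> v < heap_offset d t.+1 -> iter t tree_par v = 0.
Proof.
elim: t v => [|t IHt] v le_t lt_v; first by move: lt_v; rewrite /= muln0 add0n; lia.
have lt_top : v < top_size by apply: leq_trans lt_v _; apply: leq_heap_offset.
rewrite iterSr tree_par_top //; case: (ltnP v (heap_offset d t.+1)) => [lt_v'|le_v].
  apply: IHt (ltnW le_t) _.
  by apply: leq_ltn_trans lt_v'; apply: leq_trans (leq_div _ _) _; lia.
have /andP[_] : heap_offset d t <= v.-1 %/ d < heap_offset d t.+1.
  by apply: heap_offset_parent; rewrite ?le_v // ltnW.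
exact: IHt (ltnW le_t).
Qed.

Definition tree_height := h + 1 + (2 * bit_size (2 * D) + 3).

Lemma iter_tree_par v : v < tree_size -> exists2 k, k <= tree_height & iter k tree_par
  v = 0.
Proof.
case/vertexP=> [lt_v|[g [j [lt_g lt_j ->]]]].
  by exists h; [rewrite /tree_height; lia | apply: iter_tree_par_top].
have [k le_k Ek] := iter_gadget_par D_gt0 (bits g) lt_j.
(* [gadget_par] rests at the gadget root while [tree_par] leaves the gadget there, so the walk may
   have to stop after [i <= k] steps. *)
suff [i le_i Ei] : exists2 i, i <= k & iter i tree_par (gadget_vertex g j) =
  gadget_vertex g 0.
  exists (h + i.+1); first by rewrite /tree_height; lia.
  by rewrite iterD iterS Ei tree_par_gadget_root iter_tree_par_top // leaf_lt.
elim: k j lt_j Ek {le_k} => [|k IHk] j lt_j Ek; first by exists 0; rewrite //= -Ek.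
have [->|j0] := posnP j; first by exists 0.
rewrite iterSr in Ek; have [i le_i Ei] := IHk _ (gadget_par_lt D_gt0 _ lt_j) Ek.
by exists i.+1 => //; rewrite iterSr tree_par_gadget ?j0.
Qed.

Definition pair_tree : rtree := tree_of_par tree_size_gt0 tree_par0 tree_par_lt
  iter_tree_par.

Lemma pair_tree_height : height pair_tree <= tree_height.
Proof. exact: height_tree_of_par. Qed.

Lemma pair_tree_root v : (v != root pair_tree) = (0 < v).
Proof. by rewrite lt0n. Qed.

(** Siblings are told apart by the last [d]-ary digit in the top tree, by the rank below the leaf
    for gadget roots, and by [gadget_label] inside gadgets; the last two take at most two values,
    and [2 <= d]. Vertices of different kinds never share a parent. *)
Lemma pair_tree_max_children : max_children d pair_tree.
Proof.
pose lab v := if v < top_size then v.-1 %% d else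
  let j := (v - top_size) %% gadget_size D sd in
  if j == 0 then (v - top_size) %/ gadget_size D sd %% sd.+1 else gadget_label D j.
have lab_top v : v < top_size -> lab v = v.-1 %% d by rewrite /lab => ->.
have lab0 g : lab (gadget_vertex g 0) = g %% sd.+1.
  by rewrite /lab ltnNge gadget_vertex_ge /= gadget_vertex_divn ?gadget_vertex_modn
    ?gadget_size_gt0.
have labS g j : 0 < j < gadget_size D sd -> lab (gadget_vertex g j) = gadget_label D j.
  case/andP=> j0 lt_j; rewrite /lab ltnNge gadget_vertex_ge /= gadget_vertex_modn //.
  by rewrite -[j == 0]leqn0 leqNgt j0.
have glab_lt j : gadget_label D j < d by rewrite /gadget_label;
  repeat case: ifP => ?; lia.
have lab_lt v : lab v < d.
  rewrite /lab; case: ifP => _; first by rewrite ltn_mod; lia.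
  by case: ifP => _; rewrite ?glab_lt //; apply: leq_trans (ltn_pmod _ _) _;
    case: (sd) => //; apply: ltnW.
suff key v w : 0 < v -> 0 < w -> v < tree_size -> w < tree_size ->
    tree_par v = tree_par w -> lab v = lab w -> v = w.
  apply: (@max_children_label d pair_tree (fun v => Ordinal (lab_lt v))) => v w.
  rewrite !pair_tree_root => v0 w0 /(congr1 val)/= Ep /(congr1 val)/= El.
  by apply/val_inj/key => //; apply: ltn_ord.
move=> v0 w0 lt_v lt_w.
wlog le_vw : v w v0 w0 lt_v lt_w / v <= w.
  by move=> IH Ep El; case: (leqP v w) => [|/ltnW] ?; [apply: IH | apply/esym/IH].
case/vertexP: (lt_v) => [tv|[g [j [lt_g lt_j Ev]]]].
  case/vertexP: (lt_w) => [tw|[g [j [lt_g lt_j Ew]]]].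
    rewrite !tree_par_top // !lab_top // => Ep El.
    by have := divn_eq v.-1 d; rewrite Ep El -divn_eq; lia.
  rewrite Ew (tree_par_top tv); have [->|j0] := posnP j.
    rewrite tree_par_gadget_root => Ep _.
    have : v.-1 %/ d < heap_offset d h.
      by rewrite ltn_divLR; [move: tv; rewrite /top_size /=; lia | lia].
    by lia.
  rewrite tree_par_gadget ?j0 // => Ep _.
  have := leq_div v.-1 d; have := gadget_vertex_ge g (gadget_par sd D (bits g) j); lia.
case/vertexP: (lt_w) => [tw|[g' [j' [lt_g' lt_j' Ew]]]].
  by have := gadget_vertex_ge g j; lia.
rewrite Ev Ew.
have [->|j0] := posnP j; have [->|j0'] := posnP j'.
- rewrite !tree_par_gadget_root !lab0 => /addnI E1 E2; congr gadget_vertex.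
  by rewrite (divn_eq g sd.+1) E1 E2 -divn_eq.
- rewrite tree_par_gadget_root tree_par_gadget ?j0' //.
  by have := leaf_lt lt_g;
    have := gadget_vertex_ge g' (gadget_par sd D (bits g') j'); lia.
- rewrite tree_par_gadget_root tree_par_gadget ?j0 //.
  by have := leaf_lt lt_g'; have := gadget_vertex_ge g (gadget_par sd D (bits g) j);
    lia.
rewrite !tree_par_gadget ?j0 ?j0' // !labS ?j0 ?j0' //.
case/gadget_vertex_inj; rewrite ?gadget_par_lt // => <- E1 E2; congr gadget_vertex.
by apply: gadget_par_label_inj E1 E2; rewrite ?j0 ?j0'.
Qed.

Lemma depth_top_level t (v : 'I_(tsize pair_tree)) : t <= h ->
  heap_offset d t <= v < heap_offset d t.+1 -> depth v = t.
Proof.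
elim: t v => [|t IHt] v le_t lv.
  by rewrite (_ : v = root pair_tree) ?depth_root //; apply: val_inj => /=; move: lv;
    rewrite /=; lia.
have tv : v < top_size by case/andP: lv => _ lv; apply: leq_trans lv _;
  apply: leq_heap_offset.
rewrite depth_parent; last by rewrite pair_tree_root; move: lv; rewrite /=; lia.
by rewrite (IHt _ (ltnW le_t)) //= tree_par_top // heap_offset_parent //; lia.
Qed.

Lemma depth_top_le (v : 'I_(tsize pair_tree)) : v < top_size -> depth v <= h.
Proof. by move=> tv; apply: depth_le; apply: val_inj;
  apply: etrans (val_iter_ord_par _ _ _) (iter_tree_par_top _ _). Qed.

Lemma depth_gadget_root (v : 'I_(tsize pair_tree)) g : g < gadget_count -> v =
  gadget_vertex g 0 :> nat ->
  depth v = h.+1.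
Proof.
move=> lt_g Ev; rewrite depth_parent ?pair_tree_root; last first.
  by rewrite Ev; apply: leq_trans top_size_gt0 (gadget_vertex_ge _ _).
congr _.+1; apply: depth_top_level => //=; rewrite Ev tree_par_gadget_root leq_addr /=.
exact: leaf_lt.
Qed.

Lemma depth_gadget_gt (v : 'I_(tsize pair_tree)) g j : g < gadget_count -> 0 < j <
  gadget_size D sd ->
  v = gadget_vertex g j :> nat -> h.+1 < depth v.
Proof.
move=> lt_g; have [n] := ubnP (depth v).
elim: n v j => // n IHn v j lt_n /andP[j0 lt_j] Ev.
have v0 : v != root pair_tree.
  by rewrite pair_tree_root Ev; apply: leq_trans top_size_gt0 (gadget_vertex_ge _ _).
have Ep : parent v = gadget_vertex g (gadget_par sd D (bits g) j) :> nat.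
  by rewrite /= Ev tree_par_gadget ?j0.
move: lt_n; rewrite (depth_parent v0) !ltnS => lt_n.
have [p0|p0] := posnP (gadget_par sd D (bits g) j).
  by rewrite p0 in Ep; rewrite (depth_gadget_root lt_g Ep).
by apply: ltnW; apply: IHn lt_n _ Ep; rewrite p0 gadget_par_lt.
Qed.

(** Depths are at most [h] in the top tree and exceed [h.+1] at the other gadget vertices. As
    embeddings preserve depth, they send gadget roots to gadget roots. *)
Lemma gadget_root_of_depth (v : 'I_(tsize pair_tree)) :
  depth v = h.+1 -> exists2 g, g < gadget_count & v = gadget_vertex g 0 :> nat.
Proof.
case/vertexP: (ltn_ord v) => [tv|[g [j [lt_g lt_j Ev]]]] Ed.
  by have := depth_top_le tv; rewrite Ed ltnn.
exists g => //; have [<-//|j0] := posnP j.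
by have := depth_gadget_gt lt_g _ Ev; rewrite j0 lt_j Ed ltnn => /(_ isT).
Qed.

End TreePair.

(** * Common subtrees and orthogonal pairs *)

(* By induction on t: the automorphism that moves the parent of p to the parent of
   q is composed with a rotation of the last digit. *)
Lemma heap_automorphism d t p q : 0 < d ->
  heap_offset d t <= p < heap_offset d t.+1 -> heap_offset d t <= q < heap_offset d
    t.+1 ->
  exists s : nat -> nat, [/\ s 0 = 0 /\ s p = q,
    {in gtn (heap_offset d t.+1) &, injective s},
    forall v, 0 < v < heap_offset d t.+1 -> 0 < s v /\ (s v).-1 %/ d = s (v.-1 %/ d),
    {homo s : v / v < heap_offset d t.+1} &
    forall v, heap_offset d t <= v < heap_offset d t.+1 -> heap_offset d t <= s v <
      heap_offset d t.+1].
Proof.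
move=> d0; elim: t p q => [|t IHt] p q hp hq.
  exists id; split=> // [|v]; first by split; move: hp hq => //; rewrite /=; lia.
  by rewrite /=; lia.
have [||s [[s0 sp] s_inj s_par s_lt s_lev]] := IHt (p.-1 %/ d) (q.-1 %/ d).
- exact: heap_offset_parent.
- exact: heap_offset_parent.
(* Adding [u] modulo [d] takes the last digit of [p] to that of [q]; the summand [d] avoids a
   truncated subtraction. *)
pose u := (q.-1 %% d + (d - p.-1 %% d)).
pose s' v := if v < heap_offset d t.+1 then s v
             else d * s (v.-1 %/ d) + 1 + (v.-1 %% d + u) %% d.
have heap_offset_lt : heap_offset d t < heap_offset d t.+1 by rewrite heap_offsetS
  -addn1 leq_add2l expn_gt0 d0.
have lo v : v < heap_offset d t.+1 -> s' v = s v by rewrite /s' => ->.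
have hi v : heap_offset d t.+1 <= v -> s' v = d * s (v.-1 %/ d) + 1 + (v.-1 %% d + u)
  %% d.
  by rewrite /s' ltnNge => ->.
have par_hi v : heap_offset d t.+1 <= v -> (s' v).-1 %/ d = s (v.-1 %/ d).
  move=> /hi ->; rewrite addnAC addn1 /= mulnC divnMDl //.
  by rewrite [X in _ + X]divn_small ?addn0 // ltn_mod.
have lev_hi v : heap_offset d t.+1 <= v < heap_offset d t.+2 -> heap_offset d t.+1 <=
  s' v < heap_offset d t.+2.
  move=> lv; have /s_lev := heap_offset_parent d0 lv.
  have := par_hi v (proj1 (andP lv)); have : 0 < s' v by rewrite hi; lia.
  move: (s' v) => w w0 <-; rewrite leq_divRL // ltn_divLR //= .
  by move=> /andP[]; lia.
have s'p : s' p = q.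
  have [E1 E2] := (divn_eq p.-1 d, divn_eq q.-1 d).
  rewrite hi; last by case/andP: hp.
  rewrite sp /u addnCA subnKC; last by apply: ltnW; rewrite ltn_mod.
  rewrite modnDr modn_mod mulnC addnAC -E2 addn1 prednK //.
  by apply: leq_trans (proj1 (andP hq)); rewrite /=; lia.
exists s'; split; first by split; [rewrite lo //= addn1 | exact: s'p].
- move=> v w; rewrite !inE => lt_v lt_w.
  case: (ltnP v (heap_offset d t.+1)) => cv; case: (ltnP w (heap_offset d t.+1)) => cw.
  + by rewrite !lo //; apply: s_inj.
  + move=> E; have := lev_hi w; rewrite cw -E lo // => /(_ lt_w).
    by have := s_lt _ cv; lia.
  + move=> E; have := lev_hi v; rewrite cv E lo // => /(_ lt_v).
    by have := s_lt _ cw; lia.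
  move=> E; have Ed : v.-1 %/ d = w.-1 %/ d.
    apply: s_inj; rewrite ?inE -?par_hi ?E //.
      by case/andP: (@heap_offset_parent d t v d0 (introT andP (conj cv lt_v))).
    by case/andP: (@heap_offset_parent d t w d0 (introT andP (conj cw lt_w))).
  have Em : v.-1 %% d = w.-1 %% d.
    move: E; rewrite !hi // Ed => /addnI /eqP.
    by rewrite eqn_modDr => /eqP; rewrite !modn_mod.
  by have := divn_eq v.-1 d; rewrite Ed Em -divn_eq; move: cv cw => /=; lia.
- move=> v /andP[v0 lt_v]; case: (ltnP v (heap_offset d t.+1)) => cv.
    have [s_gt sE] := s_par v (introT andP (conj v0 cv)).
    rewrite !lo //; apply: leq_ltn_trans (leq_div _ _) _.
    exact: leq_ltn_trans (leq_pred _) cv.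
  split; first by rewrite hi; lia.
  rewrite par_hi // lo //.
  by case/andP: (@heap_offset_parent d t v d0 (introT andP (conj cv lt_v))).
- move=> v lt_v; case: (ltnP v (heap_offset d t.+1)) => cv; last first.
    by case/andP: (lev_hi v (introT andP (conj cv lt_v))).
  by rewrite lo //; apply: leq_trans (s_lt _ cv) (leq_heap_offset _ _).
exact: lev_hi.
Qed.

Section Threshold.

Variables (d h D : nat) (a b : nat -> nat -> bool).
Hypotheses (d_gt1 : 1 < d) (D_gt0 : 0 < D).
Hypothesis a0 : forall i, a i 0.
Hypothesis b_odd : forall j c, b j.*2.+1 c = (c == 0).

Notation X := (d ^ h).
Notation H := (pair_tree h false a d_gt1 D_gt0).
Notation G := (pair_tree h true b d_gt1 D_gt0).
Notation vH := (gadget_vertex d h D false).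
Notation vG := (gadget_vertex d h D true).
Notation top := (top_size d h).

(** Were a whole gadget [i] of [H] in the image of [f], going back along [f] and then along [g]
    would embed it into one gadget of [G], and the two vectors would be orthogonal. So every gadget
    has a vertex outside the image, and these [X] vertices are distinct. *)
Lemma common_subtree_le :
  (forall i j, i < X -> j < X -> exists2 c, c < D & a i c && b j.*2 c) ->
  forall T, common_subtree T H G -> tsize T + X <= tsize H.
Proof.
move=> no_orth T [[f [f_inj f0 fC]] [g [g_inj g0 gC]]].
have fP := embed_parent f0 fC; have gP := embed_parent g0 gC.
have fD := embed_depth f_inj f0 fP; have gD := embed_depth g_inj g0 gP.
have lt7 j : j < 7 * D -> j < gadget_size D false by rewrite /gadget_size addn0.
have missing (i : 'I_X) : exists2 v : 'I_(tsize H), v \notin codom f &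
    exists2 j, j < gadget_size D false & v = vH i j :> nat.
  have ltX : i < gadget_count d h false by rewrite /gadget_count muln1.
  pose vtx j : 'I_(tsize H) := insubd (root H) (vH i j).
  have vtxE j : j < gadget_size D false -> vtx j = vH i j :> nat.
    by move=> lt_j; rewrite val_insubd gadget_vertex_lt.
  have [/forallP all_in|] := boolP [forall j : 'I_(gadget_size D false), vtx j \in
    codom f];
    last first.
    by rewrite negb_forall => /existsP[j nj]; exists (vtx j) => //; exists j => //;
      apply: vtxE.
  exfalso.
  pose t j := odflt (root T) [pick x | f x == vtx j].
  have tE j : j < gadget_size D false -> f (t j) = vtx j.
    move=> lt_j; have /codomP[x Ex] := all_in (Ordinal lt_j).
    by rewrite /t; case: pickP => [y /eqP //|/(_ x)]; rewrite Ex eqxx.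
  have pos j : 0 < vH i j by apply: leq_trans (top_size_gt0 _ _) (gadget_vertex_ge _ _
    _ _ _ _).
  have tP j : 0 < j < gadget_size D false -> parent (t j) = t (gadget_par false D (a i)
    j).
    move=> /andP[j0 lt_j]; apply: f_inj; rewrite -fP !tE ?gadget_par_lt //.
    by apply: val_inj; rewrite /= !vtxE ?gadget_par_lt // tree_par_gadget ?j0.
  have t_root j : j < gadget_size D false -> g (t j) != root G.
    move=> lt_j; rewrite -g0 (inj_eq g_inj) -(inj_eq f_inj) f0 tE // pair_tree_root.
    by rewrite vtxE.
  have lt0 : 0 < gadget_size D false by rewrite gadget_size_gt0.
  have [gam lt_gam Egam] : exists2 gam, gam < gadget_count d h true & g (t 0) = vG gam
    0 :> nat.
    apply: gadget_root_of_depth; rewrite gD -fD tE //.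
    exact: depth_gadget_root ltX (vtxE _ _).
  (* The image stays in gadget [gam]: a non-root vertex whose parent lies in [gam] is neither a top
     vertex nor a gadget root, and belongs to the gadget of its parent. *)
  have inG j : j < gadget_size D false -> exists2 j', j' < gadget_size D true &
      g (t j) = vG gam j' :> nat /\ (0 < j -> 0 < j').
    move=> lt_j; have [k _ Ek] := iter_gadget_par D_gt0 (a i) lt_j.
    elim: k j lt_j Ek => [|k IHk] j lt_j Ek.
      by rewrite /= in Ek; rewrite Ek; exists 0; rewrite ?gadget_size_gt0.
    have [->|j0] := posnP j; first by exists 0; rewrite ?gadget_size_gt0.
    rewrite iterSr in Ek; have [w lt_w [Ew _]] := IHk _ (gadget_par_lt D_gt0 _ lt_j) Ek.
    rewrite -tP ?j0 // -gP /= in Ew.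
    have lt_z := ltn_ord (g (t j)); have z0 := t_root _ lt_j.
    rewrite pair_tree_root in z0; move: (nat_of_ord _) lt_z z0 Ew => z lt_z z0 Ew.
    have := gadget_vertex_ge d h D true gam w.
    case: (vertexP D_gt0 lt_z) => [tz|[g2 [j2 [lt_g2 lt_j2 Ez]]]].
      by rewrite -Ew tree_par_top //; have := leq_div z.-1 d; lia.
    rewrite Ez in Ew *; have [E0|j20] := posnP j2.
      rewrite E0 tree_par_gadget_root // in Ew.
      by have := leaf_lt lt_g2; rewrite Ew; lia.
    rewrite tree_par_gadget ?j20 // in Ew.
    have [|Eg _] := gadget_vertex_inj D_gt0 _ lt_w Ew; first exact: gadget_par_lt.
    by exists j2; rewrite // Eg.
  pose phi j := g (t j) - vG gam 0.
  have phiE j j' : g (t j) = vG gam j' :> nat -> phi j = j'.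
    by rewrite /phi => ->; rewrite /gadget_vertex addn0 addKn.
  have orth : forall c, c < D -> ~~ (a i c && b gam c).
    apply: (@gadget_embedding_orthogonal D D_gt0 (a i) (b gam) phi); first exact: phiE.
      move=> j /andP[j0 /lt7 lt_j]; have [w lt_w [Ew /(_ j0) w0]] := inG j lt_j.
      rewrite (phiE _ _ Ew) w0; split; first exact: lt_w.
      apply/esym/phiE; rewrite -tP ?j0 // -gP /= Ew tree_par_gadget ?w0 //.
    move=> j1 j2 /lt7 lt1 /lt7 lt2.
    have [w1 lt_w1 [Ew1 _]] := inG j1 lt1; have [w2 lt_w2 [Ew2 _]] := inG j2 lt2.
    rewrite (phiE _ _ Ew1) (phiE _ _ Ew2) => E; rewrite -E in Ew2.
    have /g_inj/(congr1 f) : g (t j1) = g (t j2) by apply: val_inj; rewrite /= Ew1 Ew2.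
    rewrite !tE // => /(congr1 val) /=; rewrite !vtxE // => /gadget_vertex_inj.
    by case/(_ D_gt0) => //; apply: lt7.
  (* An odd [gam] is a copy of F, and coordinate 0 is then 1 on both sides; an even one carries the
     vector that [no_orth] compares with that of [i]. *)
  have := odd_double_half gam; case: (odd gam) => /= Eg.
    by have := orth 0 D_gt0; rewrite a0 -Eg add1n b_odd.
  have [|c lt_c] := no_orth i gam./2 (ltn_ord i).
    by move: lt_gam; rewrite /gadget_count; lia.
  by rewrite -[_.*2]/(0 + _) Eg; apply/negP/orth.
have /fin_all_exists [w wP] : forall i : 'I_X, exists v : 'I_(tsize H), v \notin codom
  f /\
    exists2 j, j < gadget_size D false & v = vH i j :> nat.
  by move=> i; have [v] := missing i; exists v.
have w_inj : injective w.
  move=> i1 i2 E; have [_ [j1 lt1 E1]] := wP i1; have [_ [j2 lt2 E2]] := wP i2.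
  by rewrite E E2 in E1; have [E3 _] := gadget_vertex_inj D_gt0 lt2 lt1 E1;
    apply/esym/val_inj.
rewrite -[tsize H]card_ord -[tsize T]card_ord -[X]card_ord -(card_codom f_inj)
  -(card_codom w_inj).
rewrite -(cardC (mem (codom f))) leq_add2l;
  apply/subset_leq_card/subsetP => _ /codomP[i ->].
by rewrite inE; case: (wP i).
Qed.

(** The common subtree is [H] without one vertex from every gadget but [i0], hence without [X - 1]
    vertices. *)
Lemma common_subtree_gt i0 j0 : i0 < X -> j0 < X ->
  (forall c, c < D -> ~~ (a i0 c && b j0.*2 c)) ->
  exists2 T, common_subtree T H G & tsize H < tsize T + X.
Proof.
move=> lt_i0 lt_j0 orth.
have leafP i : i < X -> heap_offset d h <= heap_offset d h + i < heap_offset d h.+1.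
  by move=> lt_i; rewrite leq_addr heap_offsetS ltn_add2l.
have [s [[s0 sp] s_inj s_par s_lt s_lev]] :=
  heap_automorphism (ltnW d_gt1) (leafP _ lt_i0) (leafP _ lt_j0).
pose tau i := s (heap_offset d h + i) - heap_offset d h.
have tauE i : i < X -> heap_offset d h + tau i = s (heap_offset d h + i).
  by move=> /leafP/s_lev/andP[le_s _]; rewrite subnKC.
have tau_lt i : i < X -> tau i < X.
  by move=> lt_i; have /leafP/s_lev := lt_i;
    rewrite -tauE // heap_offsetS ltn_add2l => /andP[].
have tau_inj i1 i2 : i1 < X -> i2 < X -> tau i1 = tau i2 -> i1 = i2.
  move=> lt1 lt2 E; apply: (@addnI (heap_offset d h)); apply: s_inj; rewrite ?inE.
  - by case/andP: (leafP _ lt1).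
  - by case/andP: (leafP _ lt2).
  by rewrite -!tauE // E.
have tau0 : tau i0 = j0 by rewrite /tau sp addKn.
(* Gadget [i0] goes to the second-half gadget below leaf [j0], any other to the copy of F below the
   image of its leaf. *)
pose gam i := if i == i0 then j0.*2 else (tau i).*2.+1.
have gam_lt i : i < X -> gam i < gadget_count d h true.
  by move=> /tau_lt lt_t; rewrite /gam /gadget_count; case: ifP => _; lia.
have gam_half i : i < X -> gam i %/ 2 = tau i.
  by rewrite /gam; case: eqP => [->|_] _; rewrite ?tau0; lia.
have gam_inj i1 i2 : i1 < X -> i2 < X -> gam i1 = gam i2 -> i1 = i2.
  by move=> lt1 lt2 E; apply: tau_inj; rewrite // -!gam_half // E.
(* Only prolongations move: at a 1 of [a i], vertex [6 * D + c] goes to [7 * D + c], which lies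
   below [5 * D + c] in [G] if that bit of [b] is 0. *)
pose ej i j := if (6 * D <= j) && a i (j - 6 * D) then j + D else j.
have ej_lt i j : j < 7 * D -> ej i j < gadget_size D true.
  by rewrite /ej /gadget_size; case: ifP; lia.
have ej_inj i j1 j2 : j1 < 7 * D -> j2 < 7 * D -> ej i j1 = ej i j2 -> j1 = j2.
  move=> lt1 lt2; rewrite /ej; case: ifP => c1; case: ifP => c2 E; try lia.
pose e v := if v < top then s v else
  let i := (v - top) %/ gadget_size D false in
  vG (gam i) (ej i ((v - top) %% gadget_size D false)).
have e_top v : v < top -> e v = s v by rewrite /e => ->.
have e_gad i j : j < gadget_size D false -> e (vH i j) = vG (gam i) (ej i j).
  by move=> lt_j; rewrite /e ltnNge gadget_vertex_ge /= gadget_vertex_divn //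
    gadget_vertex_modn.
have g7 : gadget_size D false = 7 * D by rewrite /gadget_size addn0.
have ngX : gadget_count d h false = X by rewrite /gadget_count muln1.
have e_lt (v : 'I_(tsize H)) : e v < tsize G.
  case: (vertexP D_gt0 (ltn_ord v)) => [tv|[i [j [lt_i lt_j ->]]]].
    by rewrite e_top //; apply: leq_trans (s_lt _ tv) (leq_addr _ _).
  by rewrite e_gad // gadget_vertex_lt // ?gam_lt ?ej_lt -?ngX -?g7.
pose eo v : 'I_(tsize G) := Ordinal (e_lt v).
have e_inj : injective eo.
  move=> v w /(congr1 val) /= E; apply: val_inj => /=; move: E.
  case: (vertexP D_gt0 (ltn_ord v)) => [tv|[i [j [lt_i lt_j ->]]]].
    case: (vertexP D_gt0 (ltn_ord w)) => [tw|[i [j [lt_i lt_j ->]]]].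
      by rewrite !e_top //; apply: s_inj.
    by rewrite (e_top _ tv) e_gad // => E; have := s_lt _ tv;
      rewrite E ltnNge gadget_vertex_ge.
  case: (vertexP D_gt0 (ltn_ord w)) => [tw|[i' [j' [lt_i' lt_j' ->]]]].
    by rewrite (e_top _ tw) e_gad // => E; have := s_lt _ tw;
      rewrite -E ltnNge gadget_vertex_ge.
  rewrite !e_gad // => /gadget_vertex_inj; case/(_ D_gt0); rewrite ?ej_lt -?g7 //.
  by rewrite ngX in lt_i lt_i'; move=> /gam_inj <- // /ej_inj <- //; rewrite -g7.
(* A gadget matched with F can conflict only at coordinate 0, so its vertex [6 * D] is dropped; this
   vertex has no children, which keeps [P] closed under parents. *)
pose P (v : 'I_(tsize H)) := [forall i : 'I_X, (i != i0 :> nat) ==> (v != vH i (6 * D)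
  :> nat)].
have lt6 : 6 * D < gadget_size D false by rewrite g7; lia.
have parE (v : 'I_(tsize H)) : parent v = tree_par d h D false a v :> nat by [].
have [|||||T subT sizeT] := @common_subtree_of_map H G P eo.
- apply/forallP => i; apply/implyP => _; rewrite -[nat_of_ord _]/0 neq_ltn.
  by rewrite (leq_trans (top_size_gt0 _ _) (gadget_vertex_ge _ _ _ _ _ _)).
- move=> v _; apply/forallP => i; apply/implyP => _; rewrite parE.
  case: (vertexP D_gt0 (ltn_ord v)) => [tv|[i' [j [lt_i lt_j ->]]]].
    rewrite neq_ltn tree_par_top // (leq_trans _ (gadget_vertex_ge _ _ _ _ _ _)) //.
    by apply: leq_ltn_trans (leq_div _ _) _; apply: leq_ltn_trans (leq_pred _) tv.
  have [->|j0'] := posnP j.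
    by rewrite neq_ltn tree_par_gadget_root // (leq_trans (leaf_lt lt_i)
      (gadget_vertex_ge _ _ _ _ _ _)).
  rewrite tree_par_gadget ?j0' //; apply/eqP => /gadget_vertex_inj;
    case/(_ D_gt0) => //.
    exact: gadget_par_lt.
  by move: lt_j; rewrite g7 /gadget_par /= => lt_j _; repeat case: ifP => ?; lia.
- by move=> v w _ _; apply: e_inj.
- by apply: val_inj; rewrite /= e_top ?s0 ?top_size_gt0.
- move=> v Pv; rewrite pair_tree_root => v0; apply: val_inj => /=.
  case: (vertexP D_gt0 (ltn_ord v)) => [tv|[i [j [lt_i lt_j Ev]]]].
    have [_ sE] := s_par v (introT andP (conj v0 tv)).
    have tp : v.-1 %/ d < top.
      by apply: leq_ltn_trans (leq_div _ _) _; apply: leq_ltn_trans (leq_pred _) tv.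
    by rewrite (e_top _ tv) !tree_par_top ?s_lt // e_top.
  have lt_iX : i < X by rewrite -ngX.
  rewrite Ev e_gad //; have [E0|j0'] := posnP j.
    rewrite E0.
    have -> : ej i 0 = 0 by rewrite /ej; case: ifP; lia.
    rewrite !tree_par_gadget_root // e_top ?gam_half ?tauE // divn1 //.
    by rewrite /top; case/andP: (leafP _ lt_iX).
  have ej0 : 0 < ej i j by rewrite /ej; case: ifP; lia.
  have lt_j7 := lt_j; rewrite g7 in lt_j7.
  rewrite !tree_par_gadget ?ej0 ?j0' ?ej_lt // e_gad ?gadget_par_lt //;
    congr gadget_vertex.
  (* For [i0] this is orthogonality; in the other gadgets the only 1 of F is at coordinate 0, which
     [P] excludes. *)
  have b0 : 6 * D <= j -> a i (j - 6 * D) -> b (gam i) (j - 6 * D) = false.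
    move=> le_j aj; rewrite /gam; have [Ei|ni] := eqVneq i i0.
      have := orth (j - 6 * D); rewrite -Ei aj /= => /(_ _)/negbTE; apply; lia.
    rewrite b_odd; apply/eqP => Ej.
    move/forallP: Pv => /(_ (Ordinal lt_iX)); rewrite /= ni Ev /=.
    by rewrite (_ : j = 6 * D) ?eqxx //; lia.
  rewrite {1}/ej; case: ifP => [/andP[le_j aj]|nj].
    have -> : gadget_par false D (a i) j = j - D.
      by rewrite /gadget_par aj; repeat case: ifP => ?; lia.
    rewrite /ej leqNgt (_ : j - D < 6 * D) /=; last lia.
    have Ej : j + D - 7 * D = j - 6 * D by lia.
    by rewrite /gadget_par Ej b0 //; repeat case: ifP => ?; lia.
  have -> : gadget_par false D (a i) j = gadget_par true D (b (gam i)) j.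
    rewrite /gadget_par /=; case: (leqP (6 * D) j) nj => /= le_j nj; last first.
      by repeat case: ifP => ?; lia.
    by rewrite nj; repeat case: ifP => ?; lia.
  rewrite /ej leqNgt (_ : gadget_par true D (b (gam i)) j < 6 * D) //.
  by rewrite /gadget_par /=; repeat case: ifP => ?; lia.
exists T => //; rewrite sizeT.
suff lt_C : #|[predC P]| < X by have := cardC P; rewrite card_ord => E;
  rewrite (leq_ltn_trans (eq_leq (esym E))) ?ltn_add2l.
have vH6 (i : 'I_X) : vH i (6 * D) < tsize H by apply: gadget_vertex_lt; rewrite ?ngX.
pose w i : 'I_(tsize H) := Ordinal (vH6 i).
have : #|[predC P]| <= #|[set w i | i in predC1 (Ordinal lt_i0)]|.
  apply/subset_leq_card/subsetP => v; rewrite !inE negb_forall => /existsP[i].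
  rewrite negb_imply negbK => /andP[ni /eqP Ev].
  by apply/imsetP; exists i; [rewrite !inE | apply: val_inj].
move/leq_trans/(_ (leq_imset_card _ _)); rewrite cardC1 card_ord => le_P.
by apply: leq_ltn_trans le_P _; rewrite prednK // expn_gt0 ltnW.
Qed.

End Threshold.

(** * From satisfiability to orthogonal pairs *)

Lemma exists_bits (f : nat -> bool) u :
  exists2 i, i < 2 ^ u & forall t, t < u -> odd (i %/ 2 ^ t) = f t.
Proof.
elim: u f => [|u IHu] f; first by exists 0.
have [i lt_i iE] := IHu (fun t => f t.+1).
exists (f 0 + i.*2); first by rewrite expnS; lia.
case=> [|t] lt_t; first by rewrite expn0 divn1 oddD odd_double addbF oddb.
by rewrite -iE // expnS divnMA divn2 half_bit_double.
Qed.

Definition lit_code n (l : literal n) : nat := (val l.1).*2 + nat_of_bool l.2.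

Definition lit_codes n (F : cnf n) : seq (seq nat) :=
  [seq [seq lit_code l | l <- cl] | cl : seq (literal n) <- F].

(* The assignment is split by the parity of the variables: bit t of the number i
   is the value of variable 2t + sd. *)
Definition unsat_by (sd : bool) (i : nat) (cl : seq nat) : bool :=
  ~~ has (fun l => (odd l./2 == sd) && (odd (i %/ 2 ^ l./2./2) == odd l)) cl.

(* Coordinate 0 is the extra one; the odd gadgets of G are the copies of F. *)
Definition left_bits (cs : seq (seq nat)) (i c : nat) : bool :=
  if c is c'.+1 then unsat_by false i (nth [::] cs c') else true.

Definition right_bits (cs : seq (seq nat)) (g c : nat) : bool :=
  if odd g then c == 0
  else if c is c'.+1 then unsat_by true g./2 (nth [::] cs c') else false.

(** Each half has at most [uphalf n] variables. If [X] is larger than needed, the further numbers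
    encode half assignments too, by their low bits; this matters because [d ^ h] need not be a power
    of two. *)
Lemma satisfiable_orthogonal n (F : cnf n) X : 2 ^ uphalf n <= X ->
  reflect (exists i j, [/\ i < X, j < X & forall c, c < (size F).+1 ->
             ~~ (left_bits (lit_codes F) i c && right_bits (lit_codes F) j.*2 c)])
          (satisfiable F).
Proof.
move=> le_X; apply: (iffP existsP) => [[a /allP aF]|[i [j [_ _ orth]]]].
  pose val_of x := if insub x is Some y then a y else false.
  have [i lt_i iE] := exists_bits (fun t => val_of t.*2) (uphalf n).
  have [j lt_j jE] := exists_bits (fun t => val_of t.*2.+1) (uphalf n).
  exists i, j; split; [exact: leq_trans le_X|exact: leq_trans le_X|].
  case=> [|c]; first by rewrite /right_bits odd_double.
  rewrite ltnS /right_bits odd_double doubleK /= => lt_c.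
  rewrite (nth_map [::]) // /unsat_by -negb_or negbK.
  have /hasP[[x v] l_in /eqP /= Ev] := aF _ (mem_nth [::] lt_c).
  have lx : (lit_code (x, v))./2 = x by rewrite /lit_code /= addnC half_bit_double.
  have ox : odd (lit_code (x, v)) = v.
    by rewrite /lit_code oddD odd_double oddb.
  have lt_x : x./2 < uphalf n by have := ltn_ord x; lia.
  have := odd_double_half x; case Eo: (odd x) => Ex; apply/orP.
    right; apply/hasP; exists (lit_code (x, v)); first exact: map_f.
    rewrite lx ox Eo jE // eqxx /= -add1n Ex /val_of.
    by rewrite (insubT (fun x => x < n) (ltn_ord x)) -Ev; apply/eqP; congr (a _);
      apply: val_inj.
  left; apply/hasP; exists (lit_code (x, v)); first exact: map_f.
  rewrite lx ox Eo iE // eqxx /= -[_.*2]add0n Ex /val_of.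
  by rewrite (insubT (fun x => x < n) (ltn_ord x)) -Ev; apply/eqP; congr (a _);
    apply: val_inj.
exists [ffun x : 'I_n => odd ((if odd x then j else i) %/ 2 ^ x./2)].
apply/(all_nthP [::]) => c lt_c.
have := orth c.+1 lt_c; rewrite /right_bits odd_double doubleK /=.
rewrite (nth_map [::]) // /unsat_by -negb_or negbK -has_predU has_map.
move=> /hasP[[x v] l_in] /=.
have -> : (lit_code (x, v))./2 = x by rewrite /lit_code /= addnC half_bit_double.
have -> : odd (lit_code (x, v)) = v by rewrite /lit_code oddD odd_double oddb.
move=> h; apply/hasP; exists (x, v); rewrite //= ffunE.
by move: h; case: (odd x); rewrite ?orbF.
Qed.

Section Instance.

Variables (d h n : nat) (F : cnf n).
Hypothesis d_gt1 : 1 < d.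

Notation cs := (lit_codes F).

Definition sat_tree (sd : bool) : rtree :=
  pair_tree h sd ((if sd then right_bits else left_bits) cs) d_gt1 (ltn0Sn (size F)).

(** The threshold is the size of the first tree minus [d ^ h]: without an orthogonal pair no common
    subtree exceeds it, with one some common subtree does. *)
Lemma lcs_satisfiable m : 2 ^ uphalf n <= d ^ h ->
  largest_common_subtree_size (sat_tree false) (sat_tree true) m ->
  (tsize (sat_tree false) < m + d ^ h) = satisfiable F.
Proof.
move=> le_X [[T subT sizeT] ub].
have a0 i : left_bits cs i 0 by [].
have b_odd j c : right_bits cs j.*2.+1 c = (c == 0) by rewrite /right_bits /=
  odd_double.
apply/idP/idP => [lt_m|/(satisfiable_orthogonal F le_X)[i [j [lt_i lt_j orth]]]].
  apply: contraLR lt_m => /(satisfiable_orthogonal F le_X) no_orth.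
  rewrite -leqNgt -sizeT; apply: (common_subtree_le a0 b_odd) subT => i j lt_i lt_j.
  have [c|] := pickP [pred c : 'I_(size F).+1 | left_bits cs i c && right_bits cs j.*2
    c].
    by exists c.
  move=> noc; case: no_orth; exists i, j; split=> // c lt_c.
  by have := noc (Ordinal lt_c) => /= ->.
have [T' /ub le_m lt_T'] := common_subtree_gt d_gt1 (ltn0Sn _) b_odd lt_i lt_j orth.
by apply: leq_trans lt_T' _; rewrite leq_add2r.
Qed.

End Instance.

(** * Relocation and timed execution of programs *)

Section Relocation.

Variables kv ka : nat.

Fixpoint eshift (e : expr) : expr :=
  match e with
  | Cst n => Cst n
  | Var x => Var (kv + x)
  | Get a e1 => Get (ka + a) (eshift e1)
  | Bin o e1 e2 => Bin o (eshift e1) (eshift e2)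
  end.

Fixpoint cshift (c : cmd) : cmd :=
  match c with
  | Skip => Skip
  | Assign x e => Assign (kv + x) (eshift e)
  | Store a e1 e2 => Store (ka + a) (eshift e1) (eshift e2)
  | Seq c1 c2 => Seq (cshift c1) (cshift c2)
  | If e c1 c2 => If (eshift e) (cshift c1) (cshift c2)
  | While e c1 => While (eshift e) (cshift c1)
  end.

Definition shifted (S s : state) : Prop :=
  (forall x, vars S (kv + x) = vars s x) /\
  (forall a i, arrs S (ka + a) i = arrs s a i).

Lemma eval_shift S s e : shifted S s -> eval S (eshift e) = eval s e.
Proof. by case=> hv ha; elim: e => //= [a e ->|o e1 -> e2 ->]. Qed.

Lemma ecost_shift S s e : shifted S s -> ecost S (eshift e) = ecost s e.
Proof.
move=> h; elim: e => [n|x|a e1 IH|o e1 IH1 e2 IH2] //=.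
- by have [-> _] := h.
- by rewrite IH (eval_shift _ h) //; have [_ ->] := h.
- by rewrite IH1 IH2 !(eval_shift _ h).
Qed.

(** The copy runs in lockstep with [p] on its own region, at equal cost since the values are equal.
    Variables below [kv] survive, so the sizes found by the reduction can be read after the call. *)
Lemma exec_shift p s t s' : exec p s t s' -> forall S, shifted S s ->
  exists S', [/\ exec (cshift p) S t S', shifted S' s' &
                 forall x, x < kv -> vars S' x = vars S x].
Proof.
elim=> {p s t s'}.
- by move=> s S h; exists S; split=> //; constructor.
- move=> x e s S h; exists (set_var S (kv + x) (eval s e)); split.
  + by rewrite -(ecost_shift e h) -(eval_shift e h); constructor.
  + by case: h => hv ha; split=> //= y; rewrite /upd eqn_add2l hv.
  by move=> y lt_y; rewrite /= /upd ltn_eqF // (leq_trans lt_y) ?leq_addr.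
- move=> a e1 e2 s S h; exists (set_arr S (ka + a) (eval s e1) (eval s e2)); split=> //.
    by rewrite -!(ecost_shift _ h) -!(eval_shift _ h); constructor.
  by case: h => hv ha; split=> //= b i; rewrite /upd eqn_add2l; case: eqP => _;
    rewrite ha.
- move=> p q s s1 s2 t1 t2 _ IH1 _ IH2 S /IH1[S1 [e1 /IH2[S2 [e2 h2 f2]] f1]].
  exists S2; split=> //; first exact: ExecSeq e1 e2.
  by move=> x lt_x; rewrite f2 ?f1.
- move=> e p q s s1 t ne _ IH S h; have [S1 [e1 h1 f1]] := IH _ h.
  exists S1; split=> //; rewrite -(ecost_shift e h) /=.
  by apply: ExecIfTrue e1; rewrite (eval_shift _ h).
- move=> e p q s s1 t ne _ IH S h; have [S1 [e1 h1 f1]] := IH _ h.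
  exists S1; split=> //; rewrite -(ecost_shift e h) /=.
  by apply: ExecIfFalse e1; rewrite (eval_shift _ h).
- move=> e p s s1 s2 t1 t2 ne _ IH1 _ IH2 S h.
  have [S1 [e1 /IH2[S2 [e2 h2 f2]] f1]] := IH1 _ h.
  exists S2; split=> //.
    by rewrite -(ecost_shift e h) /=; apply: ExecWhileTrue e1 e2;
      rewrite (eval_shift _ h).
  by move=> x lt_x; rewrite f2 ?f1.
- move=> e p s e0 S h; exists S; split=> //; rewrite -(ecost_shift e h) /=.
  by apply: ExecWhileFalse; rewrite (eval_shift _ h).
Qed.

End Relocation.

(** * Size-bounded expressions and a timed program logic *)

Fixpoint esize (e : expr) : nat :=
  match e with
  | Cst _ | Var _ => 1
  | Get _ e1 => (esize e1).+1
  | Bin _ e1 e2 => (esize e1 + esize e2).+1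
  end.

Fixpoint emax (e : expr) : nat :=
  match e with
  | Cst n => n
  | Var _ => 0
  | Get _ e1 => emax e1
  | Bin _ e1 e2 => maxn (emax e1) (emax e2)
  end.

(* 40 is an arbitrary bound on the expressions of the reduction. *)
Definition small (e : expr) : bool := (esize e <= 40) && (emax e <= 40).

Lemma bitlen_le m n : m <= n -> bitlen m <= bitlen n.
Proof. by move=> le_mn; rewrite ltnS leq_trunc_log. Qed.

Lemma ltn_bitlen n : n < 2 ^ bitlen n.
Proof. exact: trunc_log_ltn. Qed.

Lemma bitlen_lt n k : 0 < k -> n < 2 ^ k -> bitlen n <= k.
Proof.
move=> k0 lt_n; have [->|n0] := posnP n; first by rewrite /bitlen trunc_log0.
by rewrite /bitlen -(ltn_exp2l _ _ (ltnSn 1)) (leq_ltn_trans (trunc_logP _ _)).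
Qed.

Section BoundedExecution.

Variables (kv ka B : nat).
Hypothesis B_ge : 40 <= B.

(* Variables from kv on and arrays from ka on are reserved for the relocated
   program, which expects them to be zero. *)
Definition good (s : state) : Prop :=
  [/\ forall x, vars s x <= B, forall a i, arrs s a i <= B,
      forall x, kv <= x -> vars s x = 0 & forall a i, ka <= a -> arrs s a i = 0].

(** A small expression has at most 40 nodes, each of value at most [B ^ 40] and so of at most
    [40 * bitlen B] bits. *)
Definition unit_cost : nat := 40 * (40 * bitlen B).

(** For positive [x] and [y], both [x + y] and [x * y] are at most [2 * x * y], hence at most
    [B * x * y]: one factor [B] per node is enough. *)
Lemma eval_le s e : good s -> small e -> eval s e <= B ^ esize e.
Proof.
move=> [gv ga _ _] /andP[_]; have B2 : 2 <= B by apply: leq_trans B_ge.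
have B0 : 0 < B by apply: ltnW.
have up k : B <= B ^ k.+1 by rewrite -{1}(expn1 B) leq_pexp2l.
elim: e => [n|x|a e1 _|o e1 IH1 e2 IH2] /=.
- by rewrite expn1 => /leq_trans; apply.
- by rewrite expn1.
- by move=> _; apply: leq_trans (ga _ _) (up _).
rewrite geq_max => /andP[/IH1 {}IH1 /IH2 {}IH2].
have E1 : 0 < B ^ esize e1 by rewrite expn_gt0 B0.
have E2 : 0 < B ^ esize e2 by rewrite expn_gt0 B0.
have P1 := leq_pmulr (B ^ esize e1) E2; have P2 := leq_pmull (B ^ esize e2) E1.
have := leq_mul B2 (leqnn (B ^ esize e1 * B ^ esize e2)).
have := leq_mul IH1 IH2; rewrite expnS expnD.
by case: o => /=; [| | |have := leq_div (eval s e1) (eval s e2)]; lia.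
Qed.

Lemma ecost_le s e : good s -> small e -> ecost s e <= unit_cost.
Proof.
move=> gs sm; suff: ecost s e <= esize e * (40 * bitlen B).
  move/leq_trans; apply; rewrite leq_mul2r; case/andP: sm => -> _.
  by rewrite orbT.
have bl e1 : small e1 -> bitlen (eval s e1) <= 40 * bitlen B.
  move=> sm1; apply: leq_trans (bitlen_le (eval_le gs sm1)) _.
  apply: bitlen_lt; first by rewrite muln_gt0.
  rewrite mulnC expnM; apply: leq_trans (_ : B ^ (esize e1) < (2 ^ bitlen B) ^ (esize
    e1)) _.
    by rewrite ltn_exp2r ?ltn_bitlen //; case: (e1).
  by rewrite leq_pexp2l ?expn_gt0 //; case/andP: sm1.
elim: e sm => [n|x|a e1 IH|o e1 IH1 e2 IH2] sm.
- by rewrite [esize _]/= mul1n [ecost _ _]/= addn0 (bl _ sm).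
- by rewrite [esize _]/= mul1n [ecost _ _]/= addn0 (bl _ sm).
- have sm1 : small e1 by case/andP: sm => /= /ltnW h1 h2; rewrite /small h1 h2.
  by rewrite [esize _]/= mulSn leq_add ?IH // (bl _ sm).
have [sm1 sm2] : small e1 /\ small e2.
  move: sm; rewrite /small /= geq_max => /andP[h1 /andP[-> ->]]; split.
    by rewrite andbT; apply: leq_trans h1; rewrite -addnS leq_addr.
  by rewrite andbT; apply: leq_trans h1; rewrite -addSn leq_addl.
by rewrite [esize _]/= mulSn mulnDl leq_add ?leq_add ?IH1 ?IH2 // (bl _ sm).
Qed.

(** Total correctness, with time in units of [unit_cost]; [good] is an invariant carried through
    every command. *)
Definition wp (c : cmd) (N : nat) (s : state) (Q : state -> Prop) : Prop :=
  good s -> exists t s', [/\ exec c s t s', t <= N * unit_cost, good s' & Q s'].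

Lemma unit_cost_gt0 : 0 < unit_cost.
Proof. by rewrite !muln_gt0. Qed.

Lemma wp_mono c N N' s (Q Q' : state -> Prop) :
  wp c N s Q -> N <= N' -> (forall s', Q s' -> Q' s') -> wp c N' s Q'.
Proof.
move=> h le_N QQ /h[t [s' [e le_t g' q]]]; exists t, s'; split; [done| |done|exact: QQ].
by apply: leq_trans le_t _; rewrite leq_mul2r le_N orbT.
Qed.

Lemma wp_skip s (Q : state -> Prop) N : 0 < N -> Q s -> wp Skip N s Q.
Proof.
move=> N0 q g; exists 1, s; split=> //; first by constructor.
by rewrite muln_gt0 N0 unit_cost_gt0.
Qed.

Lemma good_set_var s x v : good s -> x < kv -> v <= B -> good (set_var s x v).
Proof.
move=> [gv ga zv za] lt_x le_v; split=> //= y; rewrite /upd; first by case: eqP.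
by move=> le_y; rewrite gtn_eqF ?zv // (leq_trans lt_x).
Qed.

Lemma good_set_arr s a i v : good s -> a < ka -> v <= B -> good (set_arr s a i v).
Proof.
move=> [gv ga zv za] lt_a le_v; split=> //= b j; rewrite /upd.
  by case: eqP => // _; case: eqP.
by move=> le_b; rewrite gtn_eqF ?za // (leq_trans lt_a).
Qed.

Lemma wp_assign x e s N (Q : state -> Prop) : small e -> x < kv -> 0 < N ->
  eval s e <= B -> Q (set_var s x (eval s e)) -> wp (Assign x e) N s Q.
Proof.
move=> sm lt_x N0 le_e q g; exists (ecost s e), (set_var s x (eval s e)); split=> //.
- by constructor.
- by apply: leq_trans (ecost_le g sm) _; rewrite leq_pmull.
exact: good_set_var.
Qed.

(** This admits a constant such as [d], which may exceed the limit of [small]; [n <= B] bounds its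
    cost. *)
Lemma wp_const x n s N (Q : state -> Prop) : x < kv -> 0 < N -> n <= B ->
  Q (set_var s x n) -> wp (Assign x (Cst n)) N s Q.
Proof.
move=> lt_x N0 le_n q g; exists (ecost s (Cst n)), (set_var s x n); split=> //.
- exact: ExecAssign.
- rewrite /= addn0; apply: leq_trans (bitlen_le le_n) _.
  by apply: leq_trans (leq_pmull _ N0); rewrite /unit_cost mulnA leq_pmull.
exact: good_set_var.
Qed.

Lemma wp_good c N s (Q : state -> Prop) :
  (good s -> wp c N s Q) -> wp c N s Q.
Proof. by move=> h g; apply: h. Qed.

Lemma wp_store a e1 e2 s N (Q : state -> Prop) : small e1 -> small e2 -> a < ka ->
  1 < N -> eval s e2 <= B -> Q (set_arr s a (eval s e1) (eval s e2)) ->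
  wp (Store a e1 e2) N s Q.
Proof.
move=> sm1 sm2 lt_a N0 le_e q g.
exists (ecost s e1 + ecost s e2), (set_arr s a (eval s e1) (eval s e2)); split=> //.
- by constructor.
- apply: leq_trans (leq_add (ecost_le g sm1) (ecost_le g sm2)) _.
  by rewrite addnn -mul2n leq_mul2r N0 orbT.
exact: good_set_arr.
Qed.

Lemma wp_seq c1 c2 N1 N2 N s (Q : state -> Prop) :
  wp c1 N1 s (fun s1 => wp c2 N2 s1 Q) -> N1 + N2 <= N -> wp (Seq c1 c2) N s Q.
Proof.
move=> h le_N /h[t1 [s1 [e1 le1 g1 /(_ g1)[t2 [s2 [e2 le2 g2 q]]]]]].
exists (t1 + t2), s2; split=> //; first exact: ExecSeq e1 e2.
by apply: leq_trans (leq_add le1 le2) _; rewrite -mulnDl leq_mul2r le_N orbT.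
Qed.

Lemma wp_if e c1 c2 N s (Q : state -> Prop) : small e -> 0 < N ->
  (eval s e != 0 -> wp c1 N.-1 s Q) -> (eval s e = 0 -> wp c2 N.-1 s Q) ->
  wp (If e c1 c2) N s Q.
Proof.
move=> sm; case: N => // N _ /= h1 h2 g; have le_e := ecost_le g sm.
have [e0|ne] := eqVneq (eval s e) 0.
  have [t [s' [ex le_t g' q]]] := h2 e0 g; exists (ecost s e + t), s'; split=> //.
    exact: ExecIfFalse.
  by rewrite mulSn leq_add.
have [t [s' [ex le_t g' q]]] := h1 ne g; exists (ecost s e + t), s'; split=> //.
  exact: ExecIfTrue.
by rewrite mulSn leq_add.
Qed.

End BoundedExecution.

Definition For (x : nat) (e : expr) (c : cmd) : cmd :=
  Seq (Assign x (Cst 0))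
      (While (Bin Sub e (Var x)) (Seq c (Assign x (Bin Add (Var x) (Cst 1))))).

Section ForLoop.

Variables (kv ka B : nat).
Hypothesis B_ge : 40 <= B.

(** A round takes the body, a test and an increment, hence [Nb.+2]; the final 2 pays for the initial
    assignment and the failing test. *)
Lemma wp_for x e c n Nb N s (I : nat -> state -> Prop) (Q : state -> Prop) :
  small (Bin Sub e (Var x)) -> x < kv -> n <= B ->
  (forall i s', vars s' x = i -> I i s' -> eval s' e = n) ->
  I 0 (set_var s x 0) ->
  (forall i s', i < n -> vars s' x = i -> I i s' ->
     wp kv ka B c Nb s' (fun s'' => vars s'' x = i /\ I i.+1 (set_var s'' x i.+1))) ->
  (forall s', vars s' x = n -> I n s' -> Q s') ->
  n * Nb.+2 + 2 <= N ->
  wp kv ka B (For x e c) N s Q.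
Proof.
move=> sm lt_x le_n en I0 step fin le_N.
have sm1 : small (Bin Add (Var x) (Cst 1)) by [].
have loop k i s' : i + k = n -> vars s' x = i -> I i s' ->
    wp kv ka B (While (Bin Sub e (Var x)) (Seq c (Assign x (Bin Add (Var x) (Cst 1)))))
       (k * Nb.+2 + 1) s' Q.
  elim: k i s' => [|k IHk] i s' Ek xi Ii g.
    rewrite addn0 in Ek; rewrite {i}Ek in xi Ii.
    exists (ecost s' (Bin Sub e (Var x))), s'; split=> //; last exact: fin.
      by apply: ExecWhileFalse; rewrite /= (en _ _ xi Ii) xi subnn.
    by rewrite mul0n add0n mul1n (ecost_le B_ge g).
  have lt_i : i < n by rewrite -Ek addnS ltnS leq_addr.
  have [t1 [s1 [e1 le1 g1 [x1 I1]]]] := step i s' lt_i xi Ii g.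
  have x1' : eval s1 (Bin Add (Var x) (Cst 1)) = i.+1 by rewrite /= x1 addn1.
  have g2 : good kv ka B (set_var s1 x i.+1).
    by apply: good_set_var => //; apply: leq_trans lt_i le_n.
  have [||t2 [s2 [e2 le2 g3 q]]] := IHk i.+1 (set_var s1 x i.+1) _ _ I1 g2.
  - by rewrite addSnnS.
  - by rewrite /= /upd eqxx.
  exists (ecost s' (Bin Sub e (Var x)) +
          (t1 + ecost s1 (Bin Add (Var x) (Cst 1))) + t2), s2; split=> //.
    apply: ExecWhileTrue e2.
      by rewrite /= (en _ _ xi Ii) xi subn_eq0 -ltnNge.
    by apply: ExecSeq e1 _; rewrite -x1'; constructor.
  have := ecost_le B_ge g sm; have := ecost_le B_ge g1 sm1.
  move: le1 le2; rewrite mulSn; move: (k * _) => K; rewrite !mulnDl mul1n !mulSn; lia.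
apply: (@wp_seq _ _ _ _ _ 1 (n * Nb.+2 + 1)); last by lia.
by apply: wp_assign => //; apply: (loop n 0); rewrite //= /upd ?eqxx.
Qed.

End ForLoop.

(** * The reduction as a program *)

Definition Mod2 (e : expr) : expr :=
  Bin Sub e (Bin Mul (Bin Div e (Cst 2)) (Cst 2)).

Lemma eval_Mod2 s e : eval s (Mod2 e) = odd (eval s e).
Proof. by rewrite /= divn2 muln2 -{1}(odd_double_half (eval s e)) addnK. Qed.

(* Variables: 1 number of variables of the formula, 2 number of clauses, 4 power
   of two, 5 d^h, 6 number of inner vertices of the top tree, 7 number of
   coordinates, 8 half assignment, 9 position in the input, 10 clause, 12 and 13
   whether the halves leave it unsatisfied, 15 literal, 16 size of the top tree,
   17 vertex, 18 and 19 its position and its gadget, 20 its parent, 21 d, 22 and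
   23 sizes of H and G, 24 gadget size, 25 position in the output.
   Arrays: 0 input, 1 powers of two, 2 and 3 vectors of H and G, 10 output, which
   is the input array of the relocated program. *)
Definition prelude (d : nat) : cmd :=
  Seq (Assign 1 (Get 0 (Cst 0)))
  (Seq (Assign 2 (Get 0 (Cst 1)))
  (Seq (Assign 7 (Bin Add (Var 2) (Cst 1)))
  (Seq (Assign 21 (Cst d))
  (Seq (Assign 4 (Cst 1))
  (Seq (Assign 5 (Cst 1))
  (Seq (For 3 (Bin Div (Bin Add (Var 1) (Cst 1)) (Cst 2))
         (Seq (Store 1 (Var 3) (Var 4))
         (Seq (Assign 4 (Bin Mul (Var 4) (Cst 2)))
         (If (Bin Sub (Var 4) (Var 5))
            (Seq (Assign 6 (Bin Add (Var 6) (Var 5)))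
                 (Assign 5 (Bin Mul (Var 5) (Var 21))))
            Skip))))
  (Assign 16 (Bin Add (Var 6) (Var 5))))))))).

(** A literal code [x] has variable [x / 2], whose bit in its half has index [x / 4]; array 1
    supplies the power of two. The shifted assignment plus [x] is odd iff the literal is false. *)
Definition scan_literal : cmd :=
  Seq (Assign 15 (Get 0 (Var 9)))
  (Seq (Assign 9 (Bin Add (Var 9) (Cst 1)))
  (If (Mod2 (Bin Add (Bin Div (Var 8) (Get 1 (Bin Div (Var 15) (Cst 4)))) (Var 15)))
     Skip
     (If (Mod2 (Bin Div (Var 15) (Cst 2))) (Assign 13 (Cst 0)) (Assign 12 (Cst 0))))).

Definition scan_clause : cmd :=
  Seq (Assign 11 (Get 0 (Var 9)))
  (Seq (Assign 9 (Bin Add (Var 9) (Cst 1)))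
  (Seq (Assign 12 (Cst 1))
  (Seq (Assign 13 (Cst 1))
  (Seq (For 14 (Var 11) scan_literal)
  (Seq (Store 2 (Bin Add (Bin Add (Bin Mul (Var 8) (Var 7)) (Var 10)) (Cst 1)) (Var 12))
       (Store 3 (Bin Add (Bin Add (Bin Mul (Bin Mul (Cst 2) (Var 8)) (Var 7)) (Var 10))
                         (Cst 1)) (Var 13))))))).

(** One pass over the formula serves both halves: assignment [i] fills row [i] of array 2 and rows
    [2 * i] and [2 * i + 1] of array 3, the latter being F. The zeros of F and of the extra
    coordinate are never written. *)
Definition tables : cmd :=
  For 8 (Var 5)
    (Seq (Assign 9 (Cst 2))
    (Seq (Store 2 (Bin Mul (Var 8) (Var 7)) (Cst 1))
    (Seq (For 10 (Var 2) scan_clause)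
         (Store 3 (Bin Mul (Bin Add (Bin Mul (Cst 2) (Var 8)) (Cst 1)) (Var 7)) (Cst
           1))))).

(** Truncated subtraction serves as comparison: [y - x] is nonzero iff [x < y]. *)
Definition compute_gadget_par (sd : bool) : cmd :=
  let D k := Bin Mul (Cst k) (Var 7) in
  let jD k := Bin Sub (Var 18) (D k) in
  let bit k := Get (2 + sd) (Bin Add (Bin Mul (Var 19) (Var 7)) (jD k)) in
  If (Bin Sub (D 2) (Var 18))
    (If (Mod2 (Var 18)) (Assign 20 (Bin Add (D 2) (Bin Div (Var 18) (Cst 2))))
                         (Assign 20 (Bin Div (Var 18) (Cst 2))))
  (If (Bin Sub (D 4) (Var 18)) (Assign 20 (jD 2))
  (If (Bin Sub (D 5) (Var 18)) (Assign 20 (jD 3))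
  (If (Bin Sub (D 6) (Var 18)) (Assign 20 (jD 2))
  (If (Bin Sub (D 7) (Var 18))
    (if sd then Assign 20 (jD 2)
     else If (bit 6) (Assign 20 (jD 1)) (Assign 20 (jD 2)))
  (If (bit 7) (Assign 20 (jD 4)) (Assign 20 (jD 2))))))).

Definition compute_tree_par (sd : bool) : cmd :=
  If (Bin Sub (Bin Add (Var 17) (Cst 1)) (Var 16))
    (Seq (Assign 18 (Bin Sub (Var 17) (Var 16)))
    (Seq (Assign 19 (Bin Div (Var 18) (Var 24)))
    (Seq (Assign 18 (Bin Sub (Var 18) (Bin Mul (Var 19) (Var 24))))
    (If (Var 18)
      (Seq (compute_gadget_par sd)
           (Assign 20 (Bin Add (Bin Add (Var 16) (Bin Mul (Var 19) (Var 24))) (Var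
             20))))
      (Assign 20 (Bin Add (Var 6) (Bin Div (Var 19) (Cst sd.+1))))))))
    (Assign 20 (Bin Div (Bin Sub (Var 17) (Cst 1)) (Var 21))).

(* The tree is written from index [Var 25] of array 10, its size is left in
   variable 22 + sd; the root is vertex 0, so the second entry remains 0. *)
Definition write_tree (sd : bool) : cmd :=
  Seq (Assign 24 (Bin Mul (Cst (7 + sd)) (Var 7)))
  (Seq (Assign (22 + sd)
         (Bin Add (Var 16) (Bin Mul (Bin Mul (Var 5) (Cst sd.+1)) (Var 24))))
  (Seq (Store 10 (Var 25) (Var (22 + sd)))
  (For 17 (Var (22 + sd))
    (Seq (compute_tree_par sd)
         (Store 10 (Bin Add (Bin Add (Var 25) (Cst 2)) (Var 17)) (Var 20)))))).

Definition reduction (d : nat) : cmd :=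
  Seq (prelude d)
  (Seq tables
  (Seq (write_tree false)
  (Seq (Assign 25 (Bin Add (Var 22) (Cst 2)))
       (write_tree true)))).

Definition sat_program (d : nat) (p : cmd) : cmd :=
  Seq (reduction d)
  (Seq (Assign 30 (Bin Add (Bin Add (Var 22) (Var 23)) (Cst 4)))
  (Seq (cshift 30 10 p)
  (If (Bin Sub (Bin Add (Var 30) (Var 5)) (Var 22))
     (Assign 0 (Cst 1)) (Assign 0 (Cst 0))))).

(** The array is filled from left to right. The zero tail makes array 10 agree everywhere with the
    initial array of the relocated program. *)
Definition filled (arr f : nat -> nat) (b : nat) : Prop :=
  forall k, arr k = if k < b then f k else 0.

Lemma filled_upd arr f b i v :
  filled arr f b -> i = b -> v = f b -> filled (upd arr i v) f b.+1.
Proof.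
move=> h -> -> k; rewrite /upd h ltnS [k <= b]leq_eqVlt.
by have [->|] := eqVneq k b.
Qed.

Lemma filled_skip arr f b b' : filled arr f b ->
  (forall j, b <= j < b' -> f j = 0) -> b <= b' -> filled arr f b'.
Proof.
move=> h f0 le_b k; rewrite h; case: (ltnP k b) => [lt_k|le_k].
  by rewrite (leq_trans lt_k).
by case: ifP => // lt_k; rewrite f0 ?le_k.
Qed.

Definition cnf_seq (n : nat) (cs : seq (seq nat)) : seq nat :=
  n :: size cs :: flatten [seq size cl :: cl | cl : seq nat <- cs].

Lemma cnf_code_lit_codes n (F : cnf n) : cnf_code F = cnf_seq n (lit_codes F).
Proof.
rewrite /cnf_code /cnf_seq size_map -map_comp; congr [:: _, _ & flatten _].
by apply: eq_map => cl; rewrite /= /clause_code size_map.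
Qed.

(** * Verification of the reduction, phase by phase *)

Section Program.

Variables (d n k B : nat) (cs : seq (seq nat)).
Notation u := (uphalf n).
Notation m := (size cs).
Notation D := (size cs).+1.
Notation w := (cnf_seq n cs).
Hypothesis d_gt1 : 1 < d.
Hypothesis lit_lt : all (all (gtn n.*2)) cs.
Hypothesis clause_le : all (fun cl => size cl <= k) cs.
Hypothesis B_ge : 40 <= B.
Hypothesis size_w : size w <= B.
Hypothesis k_le : k <= B.
Hypothesis n_le : n.*2 + 2 <= B.
Hypothesis tree_le : 40 * (d * 2 ^ u) * D <= B.

Notation wp := (wp 30 11 B).
Notation good := (good 30 11 B).

Record env (h : nat) (s : state) : Prop := Env {
  env2 : vars s 2 = m;
  env5 : vars s 5 = d ^ h;
  env6 : vars s 6 = heap_offset d h;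
  env7 : vars s 7 = D;
  env16 : vars s 16 = top_size d h;
  env21 : vars s 21 = d;
  env_input : forall i, arrs s 0 i = nth 0 w i;
  env_pow : forall t, t < u -> arrs s 1 t = 2 ^ t
}.

Lemma size_bounds : [/\ D <= B, d <= B & 40 * (d * 2 ^ u) <= B].
Proof.
have P0 : 0 < 2 ^ u by rewrite expn_gt0.
have X0 : 0 < 40 * (d * 2 ^ u) by rewrite !muln_gt0 P0 (ltnW d_gt1).
have le_X := leq_trans (leq_pmulr (40 * (d * 2 ^ u)) (ltn0Sn (size cs))) tree_le.
split=> //; first exact: leq_trans (leq_pmull _ X0) tree_le.
by apply: leq_trans le_X; rewrite mulnCA leq_pmulr // muln_gt0 P0.
Qed.

Lemma good_init : good (init w).
Proof.
have [D_le _ _] := size_bounds.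
have le_w i : nth 0 w i <= B.
  have [le_i|lt_i] := leqP (size w) i; first by rewrite nth_default.
  have : nth 0 w i \in w by rewrite mem_nth.
  rewrite !inE => /or3P[/eqP ->|/eqP ->|/flattenP[_ /mapP[cl cl_in ->]]].
  - lia.
  - exact: ltnW.
  rewrite inE => /orP[/eqP ->|x_in].
    by apply: leq_trans k_le; have /allP/(_ cl cl_in) := clause_le.
  by have /allP/(_ cl cl_in)/allP/(_ _ x_in) := lit_lt; rewrite /=; lia.
split=> /= [x|a i|x|a i]; rewrite /upd.
- by case: eqP.
- by case: eqP.
- by case: x.
by case: a.
Qed.

Lemma wp_prelude (Q : state -> Prop) :
  (forall h s, env h s -> 2 ^ u <= d ^ h <= d * 2 ^ u ->
     (forall a i, 1 < a -> arrs s a i = 0) -> vars s 25 = 0 -> Q s) ->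
  wp (prelude d) (u * 9 + 20) (init w) Q.
Proof.
move=> HQ; rewrite /prelude.
apply: (@wp_seq _ _ _ _ _ 1 (u * 9 + 19)); last lia.
apply: wp_assign => //; first by rewrite /= /upd /=; lia.
apply: (@wp_seq _ _ _ _ _ 1 (u * 9 + 18)); last lia.
have [m_le d_le X_B] := size_bounds.
apply: wp_assign => //; first exact: ltnW.
apply: (@wp_seq _ _ _ _ _ 1 (u * 9 + 17)); last lia.
apply: wp_assign => //; first by rewrite /= addn1.
apply: (@wp_seq _ _ _ _ _ 1 (u * 9 + 16)); last lia.
apply: wp_const => //.
apply: (@wp_seq _ _ _ _ _ 1 (u * 9 + 15)); last lia.
apply: wp_assign => //; first exact: leq_trans B_ge.
apply: (@wp_seq _ _ _ _ _ 1 (u * 9 + 14)); last lia.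
apply: wp_assign => //; first exact: leq_trans B_ge.
apply: (@wp_seq _ _ _ _ _ (u * 9 + 2) 1); last lia.
(* When [2 ^ t] doubles, at most one multiplication by [d >= 2] is needed to restore
   [2 ^ t <= d ^ h <= d * 2 ^ t]. *)
pose I t s := exists h, [/\ [/\ vars s 1 = n, vars s 2 = m & vars s 7 = D],
  [/\ vars s 21 = d, vars s 5 = d ^ h, vars s 6 = heap_offset d h, vars s 25 = 0 & vars
    s 4 = 2 ^ t],
  2 ^ t <= d ^ h <= d * 2 ^ t, (forall i, arrs s 0 i = nth 0 w i) &
  (forall i, i < t -> arrs s 1 i = 2 ^ i) /\ (forall a i, 1 < a -> arrs s a i = 0)].
have pow_le t : t <= u -> 2 ^ t <= 2 ^ u by move=> le_t; rewrite leq_pexp2l.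
apply: (@wp_for 30 11 B B_ge _ _ _ u 7 _ _ I) => //.
- by apply: leq_trans n_le; lia.
- by move=> i s _ [h [[s1 _ _] _ _ _ _]]; rewrite /= s1 addn1 divn2.
- exists 0; split=> //.
  + by split=> //=; rewrite addn1.
  + by rewrite !expn0 muln1 (ltnW d_gt1).
  by split=> // -[|[|a]].
- move=> t s lt_t st [h [[s1 s2 s7] [s21 s5 s6 s25 s4] hX s0 [sP sZ]]].
  have /andP[le_X X_le] := hX.
  have := pow_le _ lt_t; rewrite expnS => le_2t.
  have le_u : 2 ^ u <= d * 2 ^ u by rewrite leq_pmull // ltnW.
  apply: (@wp_seq _ _ _ _ _ 2 5) => //; apply: wp_store => //.
    by rewrite /= s4; nia.
  apply: (@wp_seq _ _ _ _ _ 1 4) => //; apply: wp_assign => //.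
    by rewrite /= s4; nia.
  have sP' i : i < t.+1 -> upd (arrs s 1) t (2 ^ t) i = 2 ^ i.
    by rewrite /upd ltnS leq_eqVlt; case: eqP => [->|_ /= /sP].
  apply: wp_if => //= ; rewrite /upd /= s4 s5 st => hc.
    have lt_X : d ^ h < 2 ^ t * 2 by rewrite -subn_gt0 lt0n.
    have le_dX : d ^ h.+1 <= d * (2 * 2 ^ t).
      by rewrite expnS leq_mul2l mulnC ltnW ?orbT // mulnC.
    apply: (@wp_seq _ _ _ _ _ 1 2) => //; apply: wp_assign => //=; rewrite /upd /=.
      by rewrite s5 s6; have := heap_offset_lt h d_gt1; nia.
    apply: wp_assign => //=; rewrite /upd /= ?s5 ?s21.
      by rewrite -expnSr; nia.
    split=> //; exists h.+1; split=> //.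
    - by split; rewrite ?heap_offsetS ?expnSr /= /upd /= ?s5 ?s6 ?s4 ?s21.
    - by rewrite (expnS 2) le_dX andbT expnS leq_mul.
    by split=> [i|a i lt_a]; [exact: sP' | rewrite /= /upd gtn_eqF ?sZ].
  apply: wp_skip => //; split=> //; exists h; split=> //.
  - by split; rewrite ?expnSr /= /upd /= ?s5 ?s6 ?s4 ?s21.
  - by rewrite expnS; apply/andP; split; nia.
  by split=> [i|a i lt_a]; [exact: sP' | rewrite /= /upd gtn_eqF ?sZ].
move=> s _ [h [[s1 s2 s7] [s21 s5 s6 s25 s4] hX s0 [sP sZ]]].
apply: wp_assign => //=; rewrite ?s5 ?s6.
  by have := heap_offset_lt h d_gt1; have /andP[_] := hX; nia.
by apply: (HQ h) => //; split=> //=; rewrite /upd /= ?s5 ?s6 // -heap_offsetS.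
Qed.

Definition left_table j : nat := left_bits cs (j %/ D) (j %% D).
Definition right_table j : nat := right_bits cs (j %/ D) (j %% D).

Lemma left_tableE i c : c < D -> left_table (i * D + c) = left_bits cs i c.
Proof. by move=> lt_c;
  rewrite /left_table divnMDl // divn_small // modnMDl modn_small // addn0. Qed.

Lemma right_tableE i c : c < D -> right_table (i * D + c) = right_bits cs i c.
Proof. by move=> lt_c;
  rewrite /right_table divnMDl // divn_small // modnMDl modn_small // addn0. Qed.

Lemma drop_cons (s r : seq nat) p x : drop p s = x :: r ->
  [/\ p < size s, nth 0 s p = x & drop p.+1 s = r].
Proof.
move=> E; have lt_p : p < size s.
  by rewrite ltnNge; apply/negP => /drop_oversize; rewrite E.
by have := drop_nth 0 lt_p; rewrite E => -[-> ->].
Qed.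

Record row (h i : nat) (s : state) : Prop := Row {
  row_env : env h s;
  row_i : vars s 8 = i;
  row_off : vars s 25 = 0;
  row_out : forall j, arrs s 10 j = 0
}.

(** Coordinate 0 precedes those of the clauses, so after [c] clauses [c.+1] entries of the row are
    final. *)
Record clause_state h i c s : Prop := ClauseState {
  cs_row : row h i s;
  cs_pos : drop (vars s 9) w = flatten [seq size cl :: cl | cl : seq nat <- drop c cs];
  cs_A : filled (arrs s 2) left_table (i * D + c).+1;
  cs_B : filled (arrs s 3) right_table (2 * i * D + c).+1
}.

Record literal_state h i c cl r l s : Prop := LiteralState {
  ls_row : row h i s;
  ls_c : vars s 10 = c;
  ls_len : vars s 11 = size cl;
  ls_pos : drop (vars s 9) w = drop l cl ++ r;
  ls_u0 : vars s 12 = unsat_by false i (take l cl);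
  ls_u1 : vars s 13 = unsat_by true i (take l cl);
  ls_A : filled (arrs s 2) left_table (i * D + c).+1;
  ls_B : filled (arrs s 3) right_table (2 * i * D + c).+1
}.

Lemma unsat_by_rcons sd i s x : unsat_by sd i (rcons s x) =
  unsat_by sd i s && ~~ ((odd x./2 == sd) && (odd (i %/ 2 ^ x./2./2) == odd x)).
Proof. by rewrite /unsat_by has_rcons negb_or andbC. Qed.

Lemma wp_scan_literal h i c cl r l s : all (gtn n.*2) cl -> l < size cl ->
  vars s 14 = l -> literal_state h i c cl r l s ->
  wp scan_literal 6 s (fun s' => vars s' 14 = l /\
    literal_state h i c cl r l.+1 (set_var s' 14 l.+1)).
Proof.
move=> cl_lt lt_l s14 [[[e2 e5 e6 e7 e16 e21 e0 e1] s8 s25 s10] sc s11 pos s12 s13 fA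
  fB].
apply: wp_good => -[_ le_B _ _].
have Ed := drop_nth 0 lt_l; rewrite Ed in pos.
have [lt_p np dp] := drop_cons pos.
set x := nth 0 cl l in Ed pos np.
have lt_x : x < n.*2 by have /allP/(_ x (mem_nth 0 lt_l)) := cl_lt.
have Et : take l.+1 cl = rcons (take l cl) x by rewrite (take_nth 0).
have Ex : x %/ 4 = x./2./2 by rewrite -[4]/(2 * 2) divnMA !divn2.
have nx : arrs s 0 (vars s 9) = x by rewrite e0.
apply: (@wp_seq _ _ _ _ _ 1 5) => //; apply: wp_assign => //; first exact: le_B.
apply: (@wp_seq _ _ _ _ _ 1 4) => //; apply: wp_assign => //.
  by rewrite /= /upd /= addn1; apply: leq_trans size_w.
rewrite /= /upd /= nx addn1.
apply: wp_if => //; rewrite eval_Mod2 /= /upd /= s8 Ex e1 ?oddD; try lia.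
  move=> ne; apply: wp_skip => //; split=> //; split=> //=.
  - by rewrite /upd /= s12 Et unsat_by_rcons; move: ne; case: odd; case: odd;
    rewrite ?andbF ?andbT.
  - by rewrite /upd /= s13 Et unsat_by_rcons; move: ne; case: odd; case: odd;
    rewrite ?andbF ?andbT.
move=> eq0; have Eo : odd (i %/ 2 ^ x./2./2) = odd x by move: eq0; case: odd; case: odd.
apply: wp_if => //; rewrite eval_Mod2 /= /upd /= divn2 => ox.
  have o1 : odd x./2 by move: ox; case: odd.
  by apply: wp_assign => //; split=> //; split=> //=;
    rewrite /upd /= ?s12 ?s13 Et unsat_by_rcons Eo o1 ?eqxx /= ?andbF ?andbT.
have o1 : odd x./2 = false by move: ox; case: odd.
by apply: wp_assign => //; split=> //; split=> //=;
  rewrite /upd /= ?s12 ?s13 Et unsat_by_rcons Eo o1 ?eqxx /= ?andbF ?andbT.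
Qed.

Lemma wp_scan_clause h i c s : i < d ^ h -> c < m -> vars s 10 = c ->
  clause_state h i c s ->
  wp scan_clause (8 * k + 10) s (fun s' => vars s' 10 = c /\
    clause_state h i c.+1 (set_var s' 10 c.+1)).
Proof.
move=> lt_i lt_c sc [[[e2 e5 e6 e7 e16 e21 e0 e1] s8 s25 s10] pos fA fB].
apply: wp_good => -[_ le_B _ _].
rewrite (drop_nth [::] lt_c) /= in pos; have [lt_p np dp] := drop_cons pos.
set cl := nth [::] cs c in pos np dp.
have cl_in : cl \in cs by rewrite mem_nth.
have cl_lt : all (gtn n.*2) cl by have /allP/(_ _ cl_in) := lit_lt.
have cl_k : size cl <= k by have /allP/(_ _ cl_in) := clause_le.
have B1 : 1 <= B by apply: leq_trans B_ge.
apply: (@wp_seq _ _ _ _ _ 1 (8 * k + 9)); last lia.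
apply: wp_assign => //; first exact: le_B.
apply: (@wp_seq _ _ _ _ _ 1 (8 * k + 8)); last lia.
apply: wp_assign => //; first by rewrite /= /upd /= addn1; apply: leq_trans size_w.
apply: (@wp_seq _ _ _ _ _ 1 (8 * k + 7)); last lia.
apply: wp_assign => //.
apply: (@wp_seq _ _ _ _ _ 1 (8 * k + 6)); last lia.
apply: wp_assign => //.
apply: (@wp_seq _ _ _ _ _ (8 * k + 2) 4); last lia.
apply: (@wp_for 30 11 B B_ge _ _ _ (size cl) 6 _ _
  (literal_state h i c cl (flatten [seq size cl :: cl | cl : seq nat <- drop c.+1
    cs]))) => //.
- exact: leq_trans cl_k k_le.
- by move=> l s' _ [].
- by split=> //=; rewrite /upd /= ?e0 ?drop0 ?take0 // addn1.
- by move=> l s' lt_l sl hl; apply: wp_scan_literal hl.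
- move=> s' _ [[[e2' e5' e6' e7' e16' e21' e0' e1'] s8' s25' s10'] sc' s11' pos' s12'
  s13' fA' fB'].
  rewrite drop_size cat0s take_size in pos' s12' s13'.
  apply: (@wp_seq _ _ _ _ _ 2 2) => //; apply: wp_store => //.
    by rewrite /= s12'; case: unsat_by.
  rewrite /= s8' e7' sc' addn1.
  apply: wp_store => //=; first by rewrite s13'; case: unsat_by.
  rewrite s8' e7' sc' addn1 s12' s13'.
  split=> //; split=> //=; rewrite /upd /= addnS.
    by apply: filled_upd => //; rewrite -addnS left_tableE.
  apply: filled_upd => //; rewrite -addnS right_tableE //.
  by rewrite /right_bits oddM /= mul2n doubleK.
nia.
Qed.

Lemma wp_tables h s (Q : state -> Prop) : env h s -> d ^ h <= d * 2 ^ u ->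
  (forall a i, 1 < a -> arrs s a i = 0) -> vars s 25 = 0 ->
  (forall s', env h s' -> vars s' 25 = 0 -> (forall j, arrs s' 10 j = 0) ->
     filled (arrs s' 2) left_table (d ^ h * D) -> filled (arrs s' 3) right_table (2 * d
       ^ h * D) -> Q s') ->
  wp tables (d ^ h * (m * (8 * k + 12) + 9) + 2) s Q.
Proof.
move=> he le_X zA s25 HQ; have [D_le d_le X_le] := size_bounds.
have B2 : 2 <= B by apply: leq_trans B_ge.
pose I i s := [/\ env h s, vars s 25 = 0, forall j, arrs s 10 j = 0,
  filled (arrs s 2) left_table (i * D) & filled (arrs s 3) right_table (2 * i * D)].
apply: (@wp_for 30 11 B B_ge _ _ _ (d ^ h) (m * (8 * k + 12) + 7) _ _ I) => //.
- by nia.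
- by move=> i s' _ [[]].
- by case: he => *; split=> // j; rewrite /= ?zA.
- move=> i s' lt_i si [he' s25' s10' fA fB].
  apply: (@wp_seq _ _ _ _ _ 1 (m * (8 * k + 12) + 6)); last lia.
  apply: wp_assign => //.
  apply: (@wp_seq _ _ _ _ _ 2 (m * (8 * k + 12) + 4)); last lia.
  apply: wp_store => //; first exact: ltnW.
  apply: (@wp_seq _ _ _ _ _ (m * (8 * k + 12) + 2) 2); last lia.
  apply: (@wp_for 30 11 B B_ge _ _ _ m (8 * k + 10) _ _ (clause_state h i)) => //.
  + exact: ltnW.
  + by move=> c s1 _ [[[]]].
  + split=> //=; first by split=> //; case: he'; split.
    * by rewrite !drop0.
    * rewrite /upd /= addn0; apply: filled_upd => //.
        by rewrite (env7 he') si.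
      by rewrite -[_ * _]addn0 left_tableE.
    apply: filled_skip fB _ _; rewrite addn0 // => j; rewrite ltnS -eqn_leq => /eqP <-.
    by rewrite -[_ * _]addn0 right_tableE // /right_bits oddM.
  + by move=> c s1 lt_c sc hc; apply: wp_scan_clause hc.
  + move=> s1 _ [[he1 s8 s25'' s10''] _ fA1 fB1].
    apply: wp_store => //; first exact: ltnW.
    rewrite /= s8 (env7 he1); split=> //; split=> //=.
    - by case: he1; split.
    - by rewrite /upd /= mulSn addnC addnS.
    (* Row [2 * i] is complete here. Row [2 * i + 1] has its single 1 at coordinate 0, and its zeros
       need no write. *)
    have Eb : (2 * i * D + m).+1 = (2 * i + 1) * D by lia.
    rewrite Eb in fB1; apply: (@filled_skip _ _ ((2 * i + 1) * D).+1); last lia.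
      apply: filled_upd => //; rewrite -[_ * _]addn0 right_tableE //.
      by rewrite /right_bits oddD oddM.
    move=> j /andP[lo hi]; have -> : j = (2 * i + 1) * D + (j - (2 * i + 1) * D) by lia.
    rewrite right_tableE; last lia.
    by rewrite /right_bits oddD oddM andFb /= subn_eq0 leqNgt lo.
  by rewrite -addn2 -addnA.
- by move=> s' _ [? ? ? ? ?]; apply: HQ.
by rewrite -addn2 -addnA.
Qed.

Definition side_bits (sd : bool) : nat -> nat -> bool := (if sd then right_bits else
  left_bits) cs.

Definition bits_stored h sd s : Prop := forall g c, g < gadget_count d h sd -> c < D ->
  arrs s (2 + sd) (g * D + c) = side_bits sd g c.

Lemma tree_size_bound h sd : d ^ h <= d * 2 ^ u -> tree_size d h D sd + 2 <= B.
Proof.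
move=> le_X; have := leq_mul le_X (leqnn D); have := tree_size_le h sd d_gt1 (ltn0Sn m).
have : 0 < d ^ h * D by rewrite muln_gt0 expn_gt0 (ltnW d_gt1).
by move: tree_le; rewrite -mulnA; lia.
Qed.

Lemma gadget_size_le sd : gadget_size D sd <= B.
Proof.
have X0 : 0 < d * 2 ^ u by rewrite muln_gt0 expn_gt0 (ltnW d_gt1).
by apply: leq_trans tree_le; rewrite /gadget_size leq_mul2r; case: sd; lia.
Qed.

Lemma wp_compute_gadget_par h sd g j s : env h s -> bits_stored h sd s ->
  vars s 19 = g -> vars s 18 = j -> g < gadget_count d h sd -> j < gadget_size D sd ->
  wp (compute_gadget_par sd) 8 s (fun s' => s' = set_var s 20 (gadget_par sd D
    (side_bits sd g) j)).
Proof.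
move=> he bs s19 s18 lt_g lt_j; have e7 := env7 he.
have bE c : c < D -> arrs s (2 + sd) (g * D + c) = side_bits sd g c by apply: bs.
have leaf N e : small e -> 0 < N -> eval s e = gadget_par sd D (side_bits sd g) j ->
    wp (Assign 20 e) N s (fun s' => s' = set_var s 20 (gadget_par sd D (side_bits sd g)
      j)).
  move=> sm N0 E; apply: wp_assign => //; rewrite E //.
  by apply: leq_trans (gadget_size_le sd); apply/ltnW/gadget_par_lt.
have M8 : j < 8 * D by apply: leq_trans lt_j _; rewrite /gadget_size leq_mul2r;
  case: (sd) => //=.
have M7 : sd \/ j < 7 * D by move: lt_j; rewrite /gadget_size; case: (sd);
  rewrite ?addn0; [left|right].
rewrite /compute_gadget_par; have lt_sub b : b * vars s 7 - vars s 18 != 0 -> j < b * D.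
  by rewrite e7 s18 subn_eq0 -ltnNge.
have ge_sub b : b * vars s 7 - vars s 18 = 0 -> b * D <= j.
  by rewrite e7 s18 => /eqP; rewrite subn_eq0.
apply: wp_if => //= [/lt_sub j2|/ge_sub j2].
  apply: wp_if => //; rewrite eval_Mod2 /= s18 => oj; apply: leaf => //=;
    rewrite /gadget_par j2 ?e7 s18 divn2.
    by case: odd oj.
  by case: odd oj.
apply: wp_if => //= [/lt_sub j4|/ge_sub j4].
  by apply: leaf => //=; rewrite e7 s18 /gadget_par ltnNge j2 j4.
apply: wp_if => //= [/lt_sub j5|/ge_sub j5].
  by apply: leaf => //=; rewrite e7 s18 /gadget_par ltnNge j2 ltnNge j4 j5.
apply: wp_if => //= [/lt_sub j6|/ge_sub j6].
  by apply: leaf => //=; rewrite e7 s18 /gadget_par ltnNge j2 ltnNge j4 ltnNge j5 j6.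
apply: wp_if => //= [/lt_sub j7|/ge_sub j7].
  have j6' : j - 6 * D < D by lia.
  have gE : gadget_par sd D (side_bits sd g) j = if ~~ sd && side_bits sd g (j - 6 * D)
    then j - D else j - 2 * D.
    by rewrite /gadget_par ltnNge j2 ltnNge j4 ltnNge j5 ltnNge j6 j7.
  case: (sd) bE gE leaf => /= bE gE leaf.
    by apply: leaf => //=; rewrite e7 s18 gE.
  apply: wp_if => //=; rewrite s19 e7 s18 bE // => hb; apply: leaf => //=;
    rewrite e7 s18 gE ?mul1n.
    by case: left_bits hb.
  by case: left_bits hb.
have j7' : j - 7 * D < D by lia.
have gE : gadget_par sd D (side_bits sd g) j = if side_bits sd g (j - 7 * D) then j - 4
  * D else j - 2 * D.
  by rewrite /gadget_par ltnNge j2 ltnNge j4 ltnNge j5 ltnNge j6 ltnNge j7.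
apply: wp_if => //=.
  by rewrite s19 e7 s18 bE // => hb; apply: leaf => //=; rewrite e7 s18 gE;
    case: side_bits hb.
by rewrite s19 e7 s18 bE // => hb; apply: leaf => //=; rewrite e7 s18 gE;
  case: side_bits hb.
Qed.

Lemma wp_compute_tree_par h sd v s : env h s -> bits_stored h sd s ->
  d ^ h <= d * 2 ^ u -> vars s 24 = gadget_size D sd -> vars s 17 = v -> v < tree_size
    d h D sd ->
  wp (compute_tree_par sd) 16 s (fun s' => [/\ vars s' 20 = tree_par d h D sd
    (side_bits sd) v,
    arrs s' = arrs s & forall x, (x < 18) || (20 < x) -> vars s' x = vars s x]).
Proof.
move=> he bs le_X s24 s17 lt_v; have [e2 e5 e6 e7 e16 e21 e0 e1] := he.
have t_le := tree_size_bound sd le_X.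
have par_lt := tree_par_lt (sd := sd) (side_bits sd) d_gt1 (ltn0Sn m) lt_v.
apply: wp_good => -[le_B _ _ _].
have fr (s' : state) y : 18 <= y <= 20 ->
    (forall x, (x < 18) || (20 < x) -> vars s' x = vars s x) ->
    forall z x, (x < 18) || (20 < x) -> vars (set_var s' y z) x = vars s x.
  by move=> hy h' z x hx; rewrite /= /upd; case: eqP => [E|_]; [lia | apply: h'].
apply: wp_if => //= hc; last first.
  have tv : v < top_size d h by rewrite -s17 -e16; lia.
  apply: wp_assign => //=;
    rewrite s17 e21 subn1 -(tree_par_top D sd (side_bits sd) tv); first lia.
  by split=> //; apply: fr.
have tv : top_size d h <= v by rewrite -s17 -e16; lia.
apply: (@wp_seq _ _ _ _ _ 1 14) => //; apply: wp_assign => //=.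
  by apply: leq_trans (leq_subr _ _) (le_B _).
rewrite s17 e16; set r := v - top_size d h.
have r_le : r <= B by rewrite /r; lia.
apply: (@wp_seq _ _ _ _ _ 1 13) => //; apply: wp_assign => //=.
  by rewrite /upd /=; apply: leq_trans (leq_div _ _) r_le.
rewrite /upd /= s24; set g := r %/ gadget_size D sd.
apply: (@wp_seq _ _ _ _ _ 1 12) => //; apply: wp_assign => //=.
  by rewrite /upd /=; apply: leq_trans (leq_subr _ _) r_le.
rewrite /upd /= s24.
have -> : r - g * gadget_size D sd = r %% gadget_size D sd by rewrite {1}(divn_eq r
  (gadget_size D sd)) addKn.
set j := r %% gadget_size D sd.
have lt_j : j < gadget_size D sd by rewrite ltn_mod gadget_size_gt0.
have lt_g : g < gadget_count d h sd by rewrite ltn_divLR ?gadget_size_gt0 // ltn_subLR.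
have tE : tree_par d h D sd (side_bits sd) v = if j == 0 then heap_offset d h + g %/
  sd.+1
    else top_size d h + g * gadget_size D sd + gadget_par sd D (side_bits sd g) j.
  by rewrite /tree_par ltnNge tv.
have fr3 : forall x, (x < 18) || (20 < x) ->
    vars (set_var (set_var (set_var s 18 r) 19 g) 18 j) x = vars s x.
  by apply: (fr) => //; apply: (fr) => //; apply: (fr).
apply: wp_if => //=; rewrite /upd /= => hj.
  apply: (@wp_seq _ _ _ _ _ 8 1) => //.
  pose s3 := set_var (set_var (set_var s 18 r) 19 g) 18 j.
  have he3 : env h s3 by split.
  apply: wp_mono (wp_compute_gadget_par he3 bs (erefl g) (erefl j) lt_g lt_j) _ _ => //
    _ ->.
  apply: wp_assign => //=; rewrite /upd /= e16 s24.
    by rewrite (negPf hj) in tE; rewrite -tE; lia.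
  rewrite (negPf hj) in tE; split=> // x hx.
  by do ![case: eqP => [?|_]; first lia].
rewrite hj eqxx in tE; apply: wp_assign => //=; rewrite /upd /= ?e6;
  first by case: (sd).
  by rewrite -tE; lia.
by split=> // x hx; do ![case: eqP => [?|_]; first lia].
Qed.

(** [f] stands for the output of both trees together, so that the second call extends what the first
    has filled. The size of [H] in variable 22 must survive the call for [G]. *)
Lemma wp_write_tree h sd off f s (Q : state -> Prop) :
  env h s -> bits_stored h sd s -> d ^ h <= d * 2 ^ u ->
  vars s 25 = off -> filled (arrs s 10) f off ->
  f off = tree_size d h D sd -> f off.+1 = 0 ->
  (forall v, v < tree_size d h D sd -> f (off + 2 + v) = tree_par d h D sd (side_bits
    sd) v) ->
  (forall s', env h s' -> (sd -> vars s' 22 = vars s 22) ->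
    vars s' (22 + sd) = tree_size d h D sd -> (forall a, a != 10 -> arrs s' a = arrs s
      a) ->
    filled (arrs s' 10) f (off + 2 + tree_size d h D sd) -> Q s') ->
  wp (write_tree sd) (tree_size d h D sd * 20 + 6) s Q.
Proof.
move=> he bs le_X s25 fo f0 f1 fv HQ; have [e2 e5 e6 e7 e16 e21 e0 e1] := he.
have t_le := tree_size_bound sd le_X; pose S := tree_size d h D sd.
rewrite /write_tree -/S in HQ *.
apply: (@wp_seq _ _ _ _ _ 1 (S * 20 + 5)); last lia.
apply: wp_assign => //=; rewrite ?e7; first by case: (sd).
  exact: gadget_size_le.
apply: (@wp_seq _ _ _ _ _ 1 (S * 20 + 4)); last lia.
have SE : top_size d h + d ^ h * sd.+1 * ((7 + sd) * D) = S by [].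
apply: wp_assign => //=.
- by case: (sd).
- by case: (sd).
- by rewrite /upd /= e16 e5 SE; lia.
rewrite /upd /= e16 e5 SE.
apply: (@wp_seq _ _ _ _ _ 2 (S * 20 + 2)); last lia.
pose s1 := set_var (set_var s 24 ((7 + sd) * D)) (22 + sd) S.
have s1S : vars s1 (22 + sd) = S by rewrite /s1 /= /upd eqxx.
have s1f x : (x == 22 + sd) || (x == 24) = false -> vars s1 x = vars s x.
  by rewrite /s1 /= /upd => /norP[/negPf -> /negPf ->].
have s124 : vars s1 24 = gadget_size D sd by rewrite /s1 /= /upd; case: (sd).
have E25 : eval s1 (Var 25) = off by rewrite -[LHS]/(vars s1 25) s1f ?s25 //;
  case: (sd).
have ES : eval s1 (Var (22 + sd)) = S by [].
rewrite -/s1; apply: wp_store => //; first by rewrite ES; lia.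
rewrite E25 ES.
pose I v s' := [/\ env h s', vars s' 24 = gadget_size D sd /\ vars s' 25 = off,
  (sd -> vars s' 22 = vars s 22) /\ vars s' (22 + sd) = S,
  (forall a, a != 10 -> arrs s' a = arrs s a) & filled (arrs s' 10) f (off + 2 + v)].
apply: (@wp_for 30 11 B B_ge _ _ _ S 18 _ _ I) => //.
- exact: leq_trans (leq_addr _ _) t_le.
- by move=> v s' _ [_ _ []].
- split.
  + by split; rewrite /= /upd /= ?s1f //; case: (sd).
  + by split; [exact: s124 | exact: E25].
  + split; last exact: s1S.
    by move=> hsd; apply: etrans (s1f 22 _) _; rewrite // hsd.
  + by move=> a na; rewrite /= /upd (negPf na).
  rewrite /= addn0 addn2; apply: filled_skip (filled_upd fo _ _) _ _ => //.
  by move=> j; rewrite -eqn_leq => /eqP <-.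
- move=> v s' lt_v s17 [he' [s24' s25'] [s22' sS'] sa' fo'].
  have bs' : bits_stored h sd s' by move=> g c lt_g lt_c; rewrite sa' ?bs //;
    case: (sd).
  apply: (@wp_seq _ _ _ _ _ 16 2) => //.
  apply: wp_mono (wp_compute_tree_par he' bs' le_X s24' s17 lt_v) _ _ => // s2 [s20 a2
    fr2].
  have par_lt := tree_par_lt (sd := sd) (side_bits sd) d_gt1 (ltn0Sn m) lt_v.
  apply: wp_store => //=; first by rewrite s20; lia.
  have fo2 : filled (upd (arrs s2 10) (off + 2 + v) (tree_par d h D sd (side_bits sd)
    v)) f
      (off + 2 + v).+1 by apply: filled_upd; rewrite ?a2 ?fv.
  rewrite (fr2 17) // (fr2 25) // s17 s25' s20; split=> //; split.
  + by case: he'; split; rewrite /= /upd /= ?fr2 ?a2.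
  + by rewrite /= /upd /= !fr2.
  + split; first by rewrite /= /upd /= fr2.
    by rewrite -[RHS]sS' /= /upd; case: (sd) => /=; rewrite fr2.
  + by move=> a na; rewrite /= /upd (negPf na) a2 sa'.
  by rewrite (addnS (off + 2) v); exact: fo2.
- move=> s' _ [he' [s24' s25'] [s22' sS'] sa' fo'].
  exact: HQ.
Qed.

Definition tree_seq h sd : seq nat :=
  [:: tree_size d h D sd, 0 & [seq tree_par d h D sd (side_bits sd) v | v <- iota 0
    (tree_size d h D sd)]].

Lemma size_tree_seq h sd : size (tree_seq h sd) = tree_size d h D sd + 2.
Proof. by rewrite /= size_map size_iota addn2. Qed.

Lemma nth_tree_seq h sd v : v < tree_size d h D sd ->
  nth 0 (tree_seq h sd) (2 + v) = tree_par d h D sd (side_bits sd) v.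
Proof. by move=> lt_v; rewrite /= (nth_map 0) ?size_iota // nth_iota. Qed.

(** Per leaf and coordinate, the tables take up to [8 * k + 12] units and the two trees
    [2 * 18 * 20 = 720]; 800 leaves slack. *)
Definition reduction_steps : nat := 20 + u * 9 + d * 2 ^ u * D * (8 * k + 800) + 16.

Lemma wp_reduction (Q : state -> Prop) :
  (forall h s, env h s -> 2 ^ u <= d ^ h <= d * 2 ^ u ->
     vars s 22 = tree_size d h D false -> vars s 23 = tree_size d h D true ->
     (forall j, arrs s 10 j = nth 0 (tree_seq h false ++ tree_seq h true) j) -> Q s) ->
  wp (reduction d) reduction_steps (init w) Q.
Proof.
move=> HQ; set N := d * 2 ^ u * D * (8 * k + 800).
apply: (@wp_seq _ _ _ _ _ (u * 9 + 20) (N + 16)); last by rewrite /reduction_steps; lia.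
apply: wp_prelude => h s he hX zA s25; have /andP[le_X X_le] := hX.
have le_XD := leq_mul X_le (leqnn D).
have leH := tree_size_le h false d_gt1 (ltn0Sn m).
have leG := tree_size_le h true d_gt1 (ltn0Sn m).
have leN : d ^ h * (m * (8 * k + 12) + 9) + 2 + tree_size d h D false * 20 + tree_size
  d h D true * 20
    <= N + 2.
  have : d ^ h * (m * (8 * k + 12) + 9) <= d * 2 ^ u * D * (8 * k + 12).
    by rewrite -mulnA leq_mul // mulSn; lia.
  by rewrite /N !mulnDr; lia.
apply: (@wp_seq _ _ _ _ _ (d ^ h * (m * (8 * k + 12) + 9) + 2)
  (tree_size d h D false * 20 + tree_size d h D true * 20 + 13)); last lia.
apply: (wp_tables he X_le zA s25) => {zA he s25}s he s25 s10 fA fB.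
have bA s' : (forall a, a != 10 -> arrs s' a = arrs s a) -> bits_stored h false s'.
  move=> sa g c; rewrite /gadget_count muln1 => lt_g lt_c;
    rewrite sa // fA left_tableE //.
  by rewrite (leq_trans (_ : _ < g.+1 * D)) ?leq_mul2r ?lt_g ?orbT // mulSn addnC
    ltn_add2r.
have bB s' : (forall a, a != 10 -> arrs s' a = arrs s a) -> bits_stored h true s'.
  move=> sa g c; rewrite /gadget_count [_ * 2]mulnC => lt_g lt_c;
    rewrite sa // fB right_tableE //.
  by rewrite (leq_trans (_ : _ < g.+1 * D)) ?leq_mul2r ?lt_g ?orbT // mulSn addnC
    ltn_add2r.
set f := nth 0 (tree_seq h false ++ tree_seq h true) in HQ *.
have f1 j : j < tree_size d h D false + 2 -> f j = nth 0 (tree_seq h false) j.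
  by move=> lt_j; rewrite /f nth_cat size_tree_seq lt_j.
have f2 j : f (tree_size d h D false + 2 + j) = nth 0 (tree_seq h true) j.
  by rewrite /f nth_cat size_tree_seq ltnNge leq_addr addKn.
apply: (@wp_seq _ _ _ _ _ (tree_size d h D false * 20 + 6) (tree_size d h D true * 20 +
  7)); last lia.
apply: (wp_write_tree he _ X_le s25 (f := f)).
- exact: bA.
- by move=> j; rewrite s10.
- by rewrite f1 ?addn2.
- by rewrite f1 ?addn2.
- by move=> v lt_v; rewrite add0n f1 ?nth_tree_seq // addnC ltn_add2r.
move=> s1 he1 _ s22 sa1 fo1; rewrite addn0 in s22.
apply: (@wp_seq _ _ _ _ _ 1 (tree_size d h D true * 20 + 6)); last lia.
apply: wp_assign => //=; first by rewrite s22 tree_size_bound.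
rewrite s22; set s2 := set_var s1 25 _.
have he2 : env h s2 by case: he1; split.
apply: (wp_write_tree he2 _ X_le (erefl _) (f := f)).
- exact: bB.
- by rewrite add0n addnC in fo1.
- by rewrite /= /upd /= -[_ + 2]addn0 f2.
- by rewrite /= /upd /= -addn1 f2.
- by move=> v lt_v; rewrite /= /upd /= -addnA f2 nth_tree_seq.
move=> s3 he3 s22' s23 sa3 fo3; apply: (HQ h) => //.
  by rewrite s22'.
move=> j; rewrite fo3; case: ifP => // /negbT; rewrite -leqNgt => le_j.
have {}le_j : tree_size d h D false + 2 + 2 + tree_size d h D true <= j by exact: le_j.
by apply/esym/nth_default; rewrite size_cat !size_tree_seq; lia.
Qed.

End Program.

(** * The program deciding satisfiability *)

(** A clause padded with [None] to length [k] is a function from ['I_k] to [2 * n + 1] values, and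
    the clauses of [F] are distinct. *)
Lemma size_kcnf k n (F : cnf n) : is_kcnf k F -> size F <= (n.*2).+1 ^ k.
Proof.
case/andP=> uF /allP kF.
pose f (cl : seq (literal n)) : {ffun 'I_k -> option (literal n)} :=
  [ffun i : 'I_k => nth None (map Some cl) i].
have f_inj : {in F &, injective f}.
  move=> s1 s2 /kF le1 /kF le2 /ffunP E.
  apply: (inj_map (@Some_inj _)).
  have En i : nth None (map Some s1) i = nth None (map Some s2) i.
    have [le_i|lt_i] := leqP k i.
      by rewrite !nth_default // size_map; apply: leq_trans le_i.
    by have := E (Ordinal lt_i); rewrite !ffunE.
  have nz s i : (nth None (map Some s) i != None :> option (literal n)) = (i < size s).
    have [le_i|lt_i] := leqP (size s) i; first by rewrite nth_default ?size_map.
    by case: s lt_i => // x s lt_i; rewrite (nth_map x).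
  apply: (@eq_from_nth _ None) => // ; rewrite !size_map.
  apply/eqP; rewrite eqn_leq; apply/andP; split.
    by rewrite leqNgt -nz En nz ltnn.
  by rewrite leqNgt -nz -En nz ltnn.
rewrite -(size_map f); apply: leq_trans (_ : #|{ffun 'I_k -> option (literal n)}| <= _).
  have /card_uniqP <- : uniq (map f F) by rewrite map_inj_in_uniq.
  exact: max_card.
by rewrite card_ffun card_option card_prod card_bool !card_ord muln2.
Qed.

Lemma size_embeds T X : embeds T X -> tsize T <= tsize X.
Proof. by case=> f [f_inj _ _]; have := leq_card f f_inj; rewrite !card_ord. Qed.

Section SatProgram.

Variables (d n k : nat) (F : cnf n) (p : cmd) (Tp : nat).
Hypothesis d_gt1 : 1 < d.
Hypothesis kF : is_kcnf k F.

Notation u := (uphalf n).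
Notation cs := (lit_codes F).
Notation tree h sd := (sat_tree h F d_gt1 sd).

Definition value_bound : nat :=
  40 * (d * 2 ^ u) * (size F).+1 + size (cnf_code F) + k + n.*2 + 42.

Lemma tree_code_sat_tree h sd : tree_code (tree h sd) = tree_seq d cs h sd.
Proof. by rewrite tree_code_tree_of_par /tree_seq size_map; case: sd. Qed.

Hypothesis p_lcs : forall h, 2 ^ u <= d ^ h <= d * 2 ^ u -> exists m t,
  [/\ run p (tree_code (tree h false) ++ tree_code (tree h true)) m t,
      largest_common_subtree_size (tree h false) (tree h true) m & t <= Tp].

Lemma sat_program_run : exists2 t, run (sat_program d p) (cnf_code F) (satisfiable F) t
  &
  t <= (reduction_steps d n k cs + 3) * unit_cost value_bound + Tp.
Proof.
set B := value_bound; set U := unit_cost B.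
have sizeF : size cs = size F by rewrite size_map.
have B40 : 40 <= B by rewrite /B /value_bound; lia.
have lit_lt : all (all (gtn n.*2)) cs.
  rewrite all_map; apply/allP => cl _ /=; rewrite all_map; apply/allP => -[x b] _ /=.
  by have := ltn_ord x; rewrite /lit_code /=; case: b; lia.
have clause_le : all (fun cl => size cl <= k) cs.
  by rewrite all_map; case/andP: kF => _ /allP kF'; apply/allP => cl /kF' /=;
    rewrite size_map.
have good0 : good 30 11 B (init (cnf_seq n cs)).
  apply: (@good_init d n k B cs) => //;
    rewrite /B /value_bound ?sizeF ?cnf_code_lit_codes; lia.
have := @wp_reduction d n k B cs d_gt1 lit_lt clause_le B40 _ _ _ _
  (fun s => exists h, [/\ env d n cs h s, 2 ^ u <= d ^ h <= d * 2 ^ u,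
     vars s 22 = tsize (tree h false), vars s 23 = tsize (tree h true) &
     forall j, arrs s 10 j = nth 0 (tree_code (tree h false) ++ tree_code (tree h
       true)) j]).
case=> //; rewrite /B /value_bound ?sizeF ?cnf_code_lit_codes; try lia.
  move=> h s he hX s22 s23 s10; exists h; split=> //.
  by move=> j; rewrite s10 !tree_code_sat_tree.
rewrite -cnf_code_lit_codes -/value_bound -/B -/U.
move=> t1 [s1 [e1 le1 g1 [h [he hX s22 s23 s10]]]].
have [m [t2 [[s' [ep sm]] lcs le2]]] := p_lcs hX.
pose s2 := set_var s1 30 (vars s1 22 + vars s1 23 + 4).
have sz : vars s2 30 = size (tree_code (tree h false) ++ tree_code (tree h true)).
  rewrite -[LHS]/(vars s1 22 + vars s1 23 + 4) s22 s23.
  by rewrite size_cat !tree_code_sat_tree !size_tree_seq sizeF addnACA.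
(* Array 0 of [p] is array 10, already written; variables above 30 and arrays from 11 on are still
   zero by [good]. *)
have sh : shifted 30 10 s2 (init (tree_code (tree h false) ++ tree_code (tree h true))).
  case: g1 => _ _ zv za; split=> [[|x]|[|a] i] /=.
  - exact: sz.
  - by rewrite /upd /= zv.
  - by rewrite s10.
  by rewrite za.
have [s3 [e3 [sh3 _] fr3]] := exec_shift ep sh.
have e2 : exec (Assign 30 (Bin Add (Bin Add (Var 22) (Var 23)) (Cst 4))) s1
    (ecost s1 (Bin Add (Bin Add (Var 22) (Var 23)) (Cst 4))) s2 by constructor.
have le_e2 : ecost s1 (Bin Add (Bin Add (Var 22) (Var 23)) (Cst 4)) <= U by apply:
  ecost_le g1 _.
have v30 : vars s3 30 = m by rewrite -sm -(sh3 0).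
have v5 : vars s3 5 = d ^ h by rewrite fr3 //= /upd /= (env5 he).
have v22 : vars s3 22 = tsize (tree h false) by rewrite fr3.
have [le_B _ _ _] := g1.
have m_le : m <= B.
  have [[T [subT _] <-] _] := lcs; apply: leq_trans (size_embeds subT) _.
  by rewrite -s22 le_B.
have X_le : d ^ h <= B by rewrite -(env5 he) le_B.
have H_le : tsize (tree h false) <= B by rewrite -s22 le_B.
set c := Bin Sub (Bin Add (Var 30) (Var 5)) (Var 22).
have ev_c : (eval s3 c != 0) = satisfiable F.
  by rewrite /= v30 v5 v22 subn_eq0 -ltnNge (lcs_satisfiable _ lcs) //; case/andP: hX.
have b1 : 1 <= bitlen B by [].
(* The state after [p] need not be [good], so the cost of the final test is bounded directly: its
   values are at most [2 * B]. *)
have bl x : x <= 2 * B -> bitlen x <= (bitlen B).+1.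
  move=> le_x; apply: bitlen_lt => //; rewrite expnS.
  by apply: leq_ltn_trans le_x _; rewrite ltn_mul2l ltn_bitlen.
have le_c : ecost s3 c <= 10 * bitlen B.
  rewrite /= v30 v5 v22 !addn0.
  have := bl m; have := bl (d ^ h); have := bl (m + d ^ h).
  have := bl (m + d ^ h - tsize (tree h false)); have := bl (tsize (tree h false)); lia.
have [t3 [s4 [e4 le4 v0]]] : exists t3 s4,
    [/\ exec (If c (Assign 0 (Cst 1)) (Assign 0 (Cst 0))) s3 t3 s4, t3 <= 11 * bitlen B
      &
        vars s4 0 = satisfiable F].
  case: (satisfiable F) ev_c => ev_c; last move/negbT/negPn/eqP: ev_c => e0.
    exists (ecost s3 c + ecost s3 (Cst 1)), (set_var s3 0 1); split=> //.
      by apply: ExecIfTrue; [rewrite ev_c | constructor].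
    by rewrite mulSn addnC leq_add.
  exists (ecost s3 c + ecost s3 (Cst 0)), (set_var s3 0 0); split=> //.
    by apply: ExecIfFalse; [exact: e0 | constructor].
  by rewrite mulSn addnC leq_add.
exists (t1 + (ecost s1 (Bin Add (Bin Add (Var 22) (Var 23)) (Cst 4)) + (t2 + t3))).
  exists s4; split=> //; apply: ExecSeq e1 _; apply: ExecSeq e2 _; exact: ExecSeq e3 e4.
have U11 : 11 * bitlen B <= U by rewrite /U /unit_cost; lia.
rewrite mulnDl; lia.
Qed.

End SatProgram.

(** * Running time *)

Definition poly_bounded (f : nat -> nat) : Prop :=
  exists a e, forall n, f n <= a * n.+1 ^ e.

Lemma poly_bounded_const c : poly_bounded (fun=> c).
Proof. by exists c, 0 => n; rewrite muln1. Qed.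

Lemma poly_bounded_id : poly_bounded id.
Proof. by exists 1, 1 => n; rewrite mul1n expn1. Qed.

Lemma poly_bounded_mul f g :
  poly_bounded f -> poly_bounded g -> poly_bounded (fun n => f n * g n).
Proof.
move=> [a [e fP]] [b [e' gP]]; exists (a * b), (e + e') => n.
by rewrite expnD mulnACA leq_mul.
Qed.

Lemma poly_bounded_add f g :
  poly_bounded f -> poly_bounded g -> poly_bounded (fun n => f n + g n).
Proof.
move=> [a [e fP]] [b [e' gP]]; exists (a + b), (e + e') => n; rewrite mulnDl.
by apply: leq_add; [apply: leq_trans (fP n) _ | apply: leq_trans (gP n) _];
  rewrite leq_mul2l leq_pexp2l ?leq_addr ?leq_addl ?orbT.
Qed.

Lemma poly_bounded_exp f c : poly_bounded f -> poly_bounded (fun n => f n ^ c).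
Proof.
move=> fP; elim: c => [|c IHc]; first exact: poly_bounded_const.
have [a [e h]] := poly_bounded_mul fP IHc.
by exists a, e => n; rewrite expnS.
Qed.

Ltac poly_bounded_tac :=
  lazymatch goal with
  | |- poly_bounded (fun _ => ?c) => exact (poly_bounded_const c)
  | |- poly_bounded (fun n => n) => exact poly_bounded_id
  | |- poly_bounded (fun n => @?f n + @?g n) =>
      apply (@poly_bounded_add f g); poly_bounded_tac
  | |- poly_bounded (fun n => @?f n * @?g n) =>
      apply (@poly_bounded_mul f g); poly_bounded_tac
  | |- poly_bounded (fun n => @?f n ^ ?c) =>
      apply (@poly_bounded_exp f c); poly_bounded_tac
  end.

Section Bounds.

Variables (d k : nat).
Hypothesis d_gt1 : 1 < d.

Definition clauses_ub (n : nat) : nat := (n + n + 1) ^ k.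
Definition coords_ub (n : nat) : nat := clauses_ub n + 1.
Definition value_ub (n : nat) : nat :=
  40 * d * coords_ub n + (2 + clauses_ub n * (k + 1)) + k + (n + n) + 42.
Definition time_ub (n : nat) : nat :=
  (40 + 9 * n + d * coords_ub n * (8 * k + 800)) * (40 * (40 * (n + value_ub n))).
(** The first summand is for [d ^ tree_height]: [d ^ h <= d * 2 ^ uphalf n], and [d ^ bit_size (2 *
    D) <= (2 ^ d) ^ bit_size (2 * D) <= (4 * D) ^ d]. The second is for the two trees, of at most
    [18 * (d ^ h * D)] vertices each. *)
Definition size_ub (n : nat) : nat :=
  d * d ^ 4 * ((4 * coords_ub n) ^ d) ^ 2 + 36 * d * coords_ub n.

Lemma poly_bounded_time_ub : poly_bounded time_ub.
Proof.
unfold time_ub, value_ub, coords_ub, clauses_ub; poly_bounded_tac.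
Qed.

Lemma poly_bounded_size_ub : poly_bounded size_ub.
Proof.
unfold size_ub, coords_ub, clauses_ub; poly_bounded_tac.
Qed.

Lemma size_cnf_code n (F : cnf n) : all (fun cl => size cl <= k) F ->
  size (cnf_code F) <= 2 + size F * (k + 1).
Proof.
rewrite /cnf_code /= !ltnS; elim: F => //= cl F IHF /andP[le_cl /IHF le_F].
by rewrite size_cat size_map mulSn; lia.
Qed.

Variables (n : nat) (F : cnf n).
Hypothesis kF : is_kcnf k F.
Notation u := (uphalf n).

Lemma coords_le : (size F).+1 <= coords_ub n.
Proof. by rewrite /coords_ub addn1 ltnS (leq_trans (size_kcnf kF)) // /clauses_ub addn1
  addnn. Qed.

Lemma pow_gt0 : 0 < 2 ^ u.
Proof. by rewrite expn_gt0. Qed.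

Lemma reduction_time_le : (reduction_steps d n k (lit_codes F) + 3) * unit_cost
  (value_bound d k F)
  <= 2 ^ u * time_ub n.
Proof.
have D_le := coords_le; have P0 := pow_gt0.
have le_B : value_bound d k F <= 2 ^ u * value_ub n.
  have : 40 * (d * 2 ^ u) * (size F).+1 <= 2 ^ u * (40 * d * coords_ub n).
    by rewrite [40 * (d * _)]mulnA [40 * d * 2 ^ u]mulnC -mulnA !leq_mul.
  have : size (cnf_code F) <= 2 + clauses_ub n * (k + 1).
    apply: leq_trans (size_cnf_code (proj2 (andP kF))) _.
    by rewrite leq_add2l leq_mul2r; move: D_le; rewrite /coords_ub addn1 ltnS => ->;
      rewrite orbT.
  rewrite /value_bound /value_ub !mulnDr.
  have h x : x <= 2 ^ u * x by rewrite leq_pmull.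
  have := h 2; have := h (clauses_ub n * (k + 1)); have := h k; have := h n;
    have := h 42.
  rewrite mulnDr; lia.
(* The crude bound [x < 2 ^ x], applied to [value_ub n], still leaves a bit length polynomial in
   [n]. *)
have le_bl : bitlen (value_bound d k F) <= n + value_ub n.
  apply: bitlen_lt; first by rewrite /value_ub; lia.
  apply: leq_ltn_trans le_B _; apply: leq_trans (_ : 2 ^ u * 2 ^ value_ub n <= _).
    by rewrite ltn_pmul2l // ltn_expl.
  by rewrite -expnD leq_pexp2l // leq_add2r; lia.
rewrite /time_ub mulnA; apply: leq_mul; last first.
  by rewrite /unit_cost !leq_mul.
rewrite /reduction_steps size_map.
have : d * 2 ^ u * (size F).+1 * (8 * k + 800) <= 2 ^ u * (d * coords_ub n * (8 * k +
  800)).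
  rewrite [d * _]mulnC -!mulnA leq_mul2l; apply/orP; right.
  by rewrite leq_mul2l; apply/orP; right; rewrite leq_mul.
have le_u : 9 * u <= 9 * n by lia.
have h x : x <= 2 ^ u * x by rewrite leq_pmull.
have := h (40 + 9 * n); rewrite (mulnDr (2 ^ u) (40 + 9 * n)); lia.
Qed.

(** The left-hand side is the size announced to the assumed algorithm: the power of [d] makes room
    for the height, the other terms for the trees. *)
Lemma reduction_size_le h : d ^ h <= d * 2 ^ u ->
  d ^ tree_height h (size F).+1 + tsize (sat_tree h F d_gt1 false) +
  tsize (sat_tree h F d_gt1 true) <= 2 ^ u * size_ub n.
Proof.
move=> le_X; have D_le := coords_le; have P0 := pow_gt0.
have ts sd : tsize (sat_tree h F d_gt1 sd) <= 18 * (d * 2 ^ u * coords_ub n).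
  apply: leq_trans (_ : 18 * (d * 2 ^ u * (size F).+1) <= _); last by rewrite !leq_mul.
  by apply: leq_trans (tree_size_le _ _ d_gt1 (ltn0Sn _)) _; rewrite !leq_mul.
have le_lg : d ^ bit_size (2 * (size F).+1) <= (4 * coords_ub n) ^ d.
  apply: leq_trans (_ : (2 ^ d) ^ bit_size (2 * (size F).+1) <= _).
    rewrite leq_exp2r; first exact/ltnW/ltn_expl.
    by rewrite bit_size_half // muln_gt0.
  rewrite expnAC leq_exp2r; last lia.
  by apply: leq_trans (trunc_logP _ _) _ => //; lia.
have le_d : d ^ tree_height h (size F).+1 <= 2 ^ u * (d * d ^ 4 * ((4 * coords_ub n) ^
  d) ^ 2).
  have -> : tree_height h (size F).+1 = h + (4 + bit_size (2 * (size F).+1) * 2) by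
    rewrite /tree_height; lia.
  rewrite -[d * d ^ 4 * _]mulnA mulnCA mulnA !expnD expnM.
  by rewrite !leq_mul // leq_exp2r.
have := ts true; have := ts false; rewrite /size_ub mulnDr.
have -> : 2 ^ u * (36 * d * coords_ub n) = 36 * (d * 2 ^ u * coords_ub n).
  by rewrite -[36 * d * _]mulnA mulnCA [2 ^ u * _]mulnCA -[d * 2 ^ u * _]mulnA.
lia.
Qed.

End Bounds.

(** * Estimates in real numbers *)

Section Asymptotics.
Local Open Scope ring_scope.

Variable R : realType.

(** Taking logarithms gives [Hb <= log_d N], and the iterated logarithm is nonnegative since
    [log_2 N >= 1]. *)
Lemma height_le_logb (d N Hb : nat) : (1 < d)%N -> (1 < N)%N -> (d ^ Hb <= N)%N ->
  Hb%:R <= logb d%:R N%:R + 1 * logb 2 (logb 2 N%:R) :> R.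
Proof.
move=> d1 N1 le_N.
have ln_gt0' (x : nat) : (1 < x)%N -> 0 < ln (x%:R : R).
  by move=> x1; rewrite ln_gt0 // ltr1n.
have ln2 := ln_gt0' 2 isT.
have h1 : 1 <= logb (2 : R) N%:R.
  by rewrite /logb ler_pdivlMr // mul1r ler_ln ?posrE ?ltr0n // ?ler_nat; lia.
have h2 : 0 <= logb 2 (logb (2 : R) N%:R).
  by apply: divr_ge0; [exact: ln_ge0 | exact: ltW].
have h3 : Hb%:R <= logb (d%:R : R) N%:R.
  rewrite /logb ler_pdivlMr ?ln_gt0' // mulrC mulr_natr -lnXn ?ltr0n; last lia.
  by rewrite -natrX ler_ln ?posrE ?ltr0n ?ler_nat ?expn_gt0; lia.
by rewrite mul1r; apply: le_trans h3 _; rewrite lerDl.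
Qed.

(** As [uphalf n <= (n + 1) / 2], the exponent of 2 is at most [(1 - eps / 2) * (n + 1)]; rounding
    up costs the factor 2. *)
Lemma pow_half (n : nat) (eps : R) : 0 < eps -> eps <= 1 ->
  (2 ^ uphalf n)%:R `^ (2 - eps) <= 2 * 2 `^ ((1 - eps / 2) * n%:R) :> R.
Proof.
move=> e0 e1.
have le_u : (uphalf n)%:R * 2 <= n%:R + 1 :> R.
  by rewrite -natrM natr1 ler_nat; lia.
rewrite natrX -powR_mulrn // -powRrM.
have -> : 2 * 2 `^ ((1 - eps / 2) * n%:R) = 2 `^ (1 + (1 - eps / 2) * n%:R) :> R.
  by rewrite powRD ?powRr1 //; apply/implyP => _; rewrite pnatr_eq0.
apply: ler_powR; first by rewrite ler1n.
have n0 : 0 <= n%:R :> R by [].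
have u0 : 0 <= (uphalf n)%:R :> R by [].
nra.
Qed.

End Asymptotics.

Local Open Scope ring_scope.

Theorem theorem1p5 (R : realType) (d : nat) (hd : (2 <= d)%N) :
  exists2 c : R, 0 < c &
    (exists2 eps : R, 0 < eps & exists p : cmd, LCS_algorithm d c eps p) ->
    ~ SETH R.
Proof.
exists 1 => // -[eps eps0 [p [C0 lcsP]]] seth.
(* Lowering [eps] to at most 1 only weakens the assumed time bound and makes the exponent [2 - e] at
   least 1. *)
pose e := Num.min eps 1.
have e0 : 0 < e by rewrite lt_min eps0 ltr01.
have [e_eps e1] : e <= eps /\ e <= 1 by rewrite !ge_min !lexx orbT.
(* The trees have about [2 ^ (n / 2)] vertices up to polynomial factors, so the exponent [2 - e]
   turns into [(1 - e / 2) * n]. *)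
have [|k] := seth (e / 2); first by rewrite divr_gt0.
apply; have [a1 [x1 le1]] := poly_bounded_time_ub d k.
have [a2 [x2 le2]] := poly_bounded_size_ub d k.
exists (sat_program d p), (2 * a1%:R + 2 * `|C0| * (a2 ^ 2)%:R), (x1 + x2 * 2)%N.
move=> n F kF.
pose N := (2 ^ uphalf n * size_ub d k n)%N.
(* [C0] may be negative; its absolute value makes [r] nonnegative, and the truncation of [r] is the
   bound on the time of [p]. *)
pose r : R := `|C0| * N%:R `^ (2 - e).
have r0 : 0 <= r by rewrite mulr_ge0 ?powR_ge0.
have lcs h : (2 ^ uphalf n <= d ^ h <= d * 2 ^ uphalf n)%N -> exists m t,
    [/\ run p (tree_code (sat_tree h F hd false) ++ tree_code (sat_tree h F hd true)) m
      t,
        largest_common_subtree_size (sat_tree h F hd false) (sat_tree h F hd true) m &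
        (t <= Num.truncn r)%N].
  move=> /andP[_ le_X]; have := reduction_size_le hd kF le_X; rewrite -/N.
  set H := sat_tree h F hd false; set G := sat_tree h F hd true.
  set n0 := (_ + _ + _)%N => le_n0.
  have le_d : (d ^ tree_height h (size F).+1 <= n0)%N by rewrite /n0 -addnA leq_addr.
  have n0_gt1 : (1 < n0)%N.
    apply: leq_trans le_d; rewrite /tree_height addn1 addSn expnS.
    by rewrite -[2%N]muln1 leq_mul // expn_gt0 (ltnW hd).
  have ht sd : (height (sat_tree h F hd sd))%:R <= logb d%:R n0%:R + 1 * logb 2 (logb 2
    n0%:R) :> R.
    apply: le_trans (height_le_logb R hd n0_gt1 le_d).
    by rewrite ler_nat; apply: pair_tree_height.
  have [||||m [t [run_p lcs le_t]]] := lcsP n0 H G n0_gt1 _ _ _ _ (ht false) (ht true).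
  - by rewrite /n0 -addnA addnCA leq_addr.
  - by rewrite /n0 leq_addl.
  - exact: pair_tree_max_children.
  - exact: pair_tree_max_children.
  exists m, t; split=> //; rewrite truncn_ge_nat //.
  apply: le_trans le_t _; apply: le_trans (_ : `|C0| * n0%:R `^ (2 - eps) <= _).
    by rewrite ler_wpM2r ?powR_ge0 ?ler_norm.
  rewrite ler_wpM2l //; apply: le_trans (_ : n0%:R `^ (2 - e) <= _).
    by rewrite ler_powR ?ler1n ?(ltnW n0_gt1) // lerD2l lerN2.
  rewrite ge0_ler_powR ?nnegrE ?ler_nat //; lra.
have [t run_t le_t] := sat_program_run (d_gt1 := hd) kF lcs.
exists t => //.
have P0 : 0 <= 2 `^ ((1 - e / 2) * n%:R) :> R by rewrite powR_ge0.
set P := 2 `^ _ in P0 *.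
have leU : (2 ^ uphalf n)%:R `^ (2 - e) <= 2 * P by apply: pow_half.
have U1 : 1 <= (2 ^ uphalf n)%:R :> R by rewrite ler1n expn_gt0.
have leU1 : (2 ^ uphalf n)%:R <= 2 * P.
  apply: le_trans leU; rewrite -[X in X <= _]powRr1 //.
  by rewrite ler_powR //; lra.
have leT : (2 ^ uphalf n * time_ub d k n)%:R <= 2 * P * (a1%:R * n.+1%:R ^+ x1).
  by rewrite natrM ler_pM // -natrX -natrM ler_nat.
have S1 : 1 <= (size_ub d k n)%:R :> R.
  by rewrite ler1n /size_ub addn_gt0 !muln_gt0 !expn_gt0 muln_gt0 /coords_ub addn1
    (ltnW hd).
(* As the base is at least 1 and [2 - e <= 2], the square is an upper bound, whence [a2 ^ 2] and
   [x2 * 2]. *)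
have leS : (size_ub d k n)%:R `^ (2 - e) <= (a2 ^ 2)%:R * n.+1%:R ^+ (x2 * 2) :> R.
  apply: le_trans (_ : (size_ub d k n)%:R `^ 2%:R <= _).
    by rewrite ler_powR //; lra.
  by rewrite powR_mulrn // exprM natrX -exprMn lerXn2r ?nnegrE ?mulr_ge0 ?exprn_ge0 //
    -natrX -natrM ler_nat.
have leR : r <= 2 * P * (`|C0| * (a2 ^ 2)%:R * n.+1%:R ^+ (x2 * 2)).
  rewrite /r /N natrM powRM //.
  apply: le_trans (ler_wpM2l _ (ler_pM _ _ leU leS)) _; rewrite ?powR_ge0 //.
  by rewrite mulrCA [_ * (_ * n.+1%:R ^+ _)]mulrA.
have : (t%:R : R) <= (2 ^ uphalf n * time_ub d k n)%:R + r.
  apply: le_trans (_ : (2 ^ uphalf n * time_ub d k n + Num.truncn r)%:R <= _).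
    by rewrite ler_nat; apply: leq_trans le_t _;
      rewrite leq_add2r (reduction_time_le hd kF).
  by rewrite natrD lerD2l truncn_le.
move=> /le_trans; apply; apply: le_trans (lerD leT leR) _.
have y1 : n.+1%:R ^+ x1 <= n.+1%:R ^+ (x1 + x2 * 2) :> R by rewrite ler_weXn2l ?ler1n
  ?leq_addr.
have y2 : n.+1%:R ^+ (x2 * 2) <= n.+1%:R ^+ (x1 + x2 * 2) :> R by rewrite ler_weXn2l
  ?ler1n ?leq_addl.
set Y := n.+1%:R ^+ (x1 + _) in y1 y2 *.
have h1 : P * (2 * a1%:R) * n.+1%:R ^+ x1 <= P * (2 * a1%:R) * Y.
  by rewrite ler_wpM2l // !mulr_ge0.
have h2 : P * (2 * `|C0| * (a2 ^ 2)%:R) * n.+1%:R ^+ (x2 * 2) <=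
    P * (2 * `|C0| * (a2 ^ 2)%:R) * Y.
  by rewrite ler_wpM2l // !mulr_ge0.
lra.
Qed.
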